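(* Let $r^e=m\ge -1$ and $r^v\ge \max\{2r^e,-1\}$ be integers, and let $k\ge 2r^v+1$ be a nonnegative integer. Let $T\subset\mathbb R^2$ be a triangle. The shape function space $\mathbb P_k(T)$ is determined (i.e. the following set of linear functionals is unisolvent for $\mathbb P_k(T)$) by the degrees of freedom $$D^{\alpha}u(v),\quad \alpha\in\mathbb N^2,\ |\alpha|\le r^v,\ v \text{ a vertex of } T,$$ $$\int_e \frac{\partial^{\beta}u}{\partial n_e^{\beta}}\,q\,ds,\quad q\in\mathbb P_{k-2(r^v+1)+\beta}(e),\ \beta=0,\ldots,r^e,\ e\text{ an edge of }T,$$ $$\int_T u\,q\,dx,\quad q\in\mathbb B_k(\boldsymbol r;T),\qquad \boldsymbol r=(r^v,r^e).$$
   Context: $\mathbb P_j(D)$ is the space of real polynomials of degree at most $j$ on $D$ ($\{0\}$ if $j<0$). For $\alpha=(\alpha_1,\alpha_2)\in\mathbb N^2$ (with $0\in\mathbb N$), $D^\alpha=\partial^{|\alpha|}/\partial x_1^{\alpha_1}\partial x_2^{\alpha_2}$; $n_e$ is a unit normal of the edge $e$. Index ranges such as $\beta=0,\dots,r^e$ are empty if $r^e=-1$, and there are no vertex degrees of freedom if $r^v=-1$. Degrees of freedom given as moments against a space of test functions $q$ mean the functionals obtained by letting $q$ run through a basis of that space; ''determined/unisolvent'' means that the number of functionals equals the dimension of the space and only the zero function annihilates all of them. Let $\lambda_0,\lambda_1,\lambda_2$ be the barycentric coordinates of $T$ with respect to its vertices $v_0,v_1,v_2$ and, for $\alpha=(\alpha_0,\alpha_1,\alpha_2)\in\mathbb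 N^3$, $\lambda^\alpha=\lambda_0^{\alpha_0}\lambda_1^{\alpha_1}\lambda_2^{\alpha_2}$. The polynomial bubble space is $$\mathbb B_k(\boldsymbol r;T)=\operatorname{span}\{\lambda^\alpha:\ \alpha\in\mathbb N^3,\ |\alpha|=k,\ k-\alpha_i>r^v \text{ and } \alpha_i>r^e\ \text{ for } i=0,1,2\}.$$ *)

(* Defs.v *)
From HB Require Import structures.
From mathcomp Require Import all_boot all_order all_algebra.
(* The notations of mpoly clash with those of mathcomp-analysis; only its
   definitions, coercions and canonical structures are imported. *)
From mathcomp.multinomials Require Export -(notations) mpoly.
From mathcomp Require Import all_classical all_reals all_analysis.
From mathcomp Require Import ring lra.

Set Implicit Arguments.
Unset Strict Implicit.
Unset Printing Implicit Defensive.

Import Order.TTheory GRing.Theory Num.Theory.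
Import numFieldNormedType.Exports.

Local Open Scope classical_set_scope.
Local Open Scope ring_scope.

Section LinearAlgebra.
Variables (R : realType) (V : lmodType R).

Definition linspan (S : set V) : set V :=
  [set w | exists (n : nat) (c : 'I_n -> R) (g : 'I_n -> V),
     (forall i, S (g i)) /\ w = \sum_(i < n) c i *: g i].

Definition lin_free (s : seq V) : Prop :=
  forall c : 'I_(size s) -> R,
    \sum_(i < size s) c i *: s`_i = 0 -> forall i, c i = 0.

Definition is_basis (P : set V) (s : seq V) : Prop :=
  lin_free s /\ linspan [set` s] = P.

Definition has_dim (P : set V) (n : nat) : Prop :=
  exists s : seq V, is_basis P s /\ size s = n.

(* A functional is given by its values on the whole of [V]; repetitions in
   [L] are counted. *)
Definition unisolvent (P : set V) (L : seq (V -> R)) : Prop :=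
  has_dim P (size L) /\
  (forall u, P u -> (forall l, l \in L -> l u = 0) -> u = 0).

End LinearAlgebra.

Section Polynomials.
Variable R : realType.
Local Notation point := (R * R)%type.
Local Notation poly2 := (mpoly 2 R).

Definition peval (p : poly2) (x : point) : R :=
  meval (fun i : 'I_2 => if i == 0 then x.1 else x.2) p.

(* Bounding the degree monomial by monomial makes the space {0} for j < 0.
   Polynomials on a triangle T are represented by their coefficients; this is
   harmless by [restrict_triangle_inj] below. *)
Definition polys (j : int) : set poly2 :=
  [set p | forall m, m \in msupp p -> (mdeg m)%:Z <= j].

(* P_j(D) as a space of functions on D (extended by 0 outside D).  On an edge
   distinct polynomials may have the same restriction. *)
Definition polys_on (j : int) (D : set point) : set (point -> R) :=
  [set f | exists2 p, polys j p & f = peval p \_ D].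

Definition dirderiv (n : point) (p : poly2) : poly2 :=
  n.1 *: mderiv 0 p + n.2 *: mderiv 1 p.

End Polynomials.

Section Triangle.
Variable R : realType.
Local Notation point := (R * R)%type.
Local Notation poly2 := (mpoly 2 R).

(* Twice the signed area of the triangle abc. *)
Definition orient (a b c : point) : R :=
  (b.1 - a.1) * (c.2 - a.2) - (b.2 - a.2) * (c.1 - a.1).

Definition is_triangle (v : 'I_3 -> point) : Prop :=
  orient (v 0) (v 1) (v 2) != 0.

Definition triangle (v : 'I_3 -> point) : set point :=
  [set x | exists l : 'I_3 -> R,
     [/\ forall i, 0 <= l i, \sum_i l i = 1 & x = \sum_i l i *: v i]].

Definition segment (a b : point) : set point :=
  [set x | exists2 t : R, 0 <= t <= 1 & x = a + t *: (b - a)].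

(* The edge [i] is opposite to the vertex [v i]; addition in 'I_3 is modulo
   3. *)
Definition edge_src (v : 'I_3 -> point) (i : 'I_3) : point := v (i + 1).
Definition edge_tgt (v : 'I_3 -> point) (i : 'I_3) : point := v (i + 2).

Definition edge (v : 'I_3 -> point) (i : 'I_3) : set point :=
  segment (edge_src v i) (edge_tgt v i).

(* The library norm on [R * R] is the sup norm. *)
Definition euclid_norm (x : point) : R := Num.sqrt (x.1 ^+ 2 + x.2 ^+ 2).

Definition unit_normal (v : 'I_3 -> point) (i : 'I_3) (n : point) : Prop :=
  let d := edge_tgt v i - edge_src v i in
  n.1 * d.1 + n.2 * d.2 = 0 /\ euclid_norm n = 1.

(* Arc-length integral, through the constant speed parametrization of the
   edge by [0, 1]. *)
Definition edge_integral (v : 'I_3 -> point) (i : 'I_3) (f : point -> R) : R :=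
  let d := edge_tgt v i - edge_src v i in
  euclid_norm d *
  \int[lebesgue_measure]_(t in `[0, 1]) f (edge_src v i + t *: d).

Definition triangle_integral (v : 'I_3 -> point) (f : point -> R) : R :=
  \int[(lebesgue_measure \x lebesgue_measure)%E]_(x in triangle v) f x.

(* The barycentric coordinate of v_i at x is
   orient x v_(i+1) v_(i+2) / orient v_i v_(i+1) v_(i+2), which is expanded
   here in the coordinates of x; see [sum_bary] and [sum_bary_vertices]. *)
Definition bary (v : 'I_3 -> point) (i : 'I_3) : poly2 :=
  let b := v (i + 1) in let c := v (i + 2) in
  (orient (v i) b c)^-1 *:
    (mpolyC 2 (b.1 * c.2 - b.2 * c.1)
     + (b.2 - c.2) *: mpolyX R (mnm1 0) + (c.1 - b.1) *: mpolyX R (mnm1 1)).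

Definition bubble (k : nat) (rv re : int) (v : 'I_3 -> point) : set poly2 :=
  linspan [set q | exists alpha : multinom 3,
    [/\ mdeg alpha = k,
        forall i, rv < k%:Z - (alpha i)%:Z,
        forall i, re < (alpha i)%:Z
      & q = \prod_(i < 3) bary v i ^+ alpha i]].

(* [bmultinom 2 n] is the finite type of the multi-indices of degree < n. *)
Definition vertex_dofs (rv : int) (v : 'I_3 -> point) : seq (poly2 -> R) :=
  [seq (fun u : poly2 => peval (mderivm (bmnm alpha) u) (v i))
     | i <- enum 'I_3, alpha <- enum {: bmultinom 2 (absz (rv + 1)%R)}].

(* [bE i beta] lists the test functions used on the edge [i] for the normal
   derivative of order [beta]. *)
Definition edge_dofs (re : int) (v n : 'I_3 -> point)
    (bE : 'I_3 -> nat -> seq (point -> R)) : seq (poly2 -> R) :=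
  flatten
    [seq [seq (fun u : poly2 => edge_integral v i
                 (fun x => peval (iter beta (dirderiv (n i)) u) x * q x))
            | q <- bE i beta]
       | i <- enum 'I_3, beta <- iota 0 (absz (re + 1))].

Definition interior_dofs (v : 'I_3 -> point) (bT : seq poly2) :
    seq (poly2 -> R) :=
  [seq (fun u : poly2 => triangle_integral v (fun x => peval u x * peval q x))
     | q <- bT].

End Triangle.

Section Checks.
Variable R : realType.
Local Notation point := (R * R)%type.
Local Notation poly2 := (mpoly 2 R).
Implicit Types (v : 'I_3 -> point) (p : poly2).

Lemma peval_bary v i x :
  peval (bary v i) x =
  orient x (v (i + 1)) (v (i + 2)) / orient (v i) (v (i + 1)) (v (i + 2)).
Proof.
rewrite /peval /bary mevalZ !mevalD !mevalZ mevalC !mevalXU /= mulrC.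
by congr (_ * _); rewrite /orient; ring.
Qed.

Lemma sum3E (V : nmodType) (F : 'I_3 -> V) :
  \sum_i F i = F 0 + F 1 + F 2.
Proof.
rewrite !big_ord_recl big_ord0 addr0 addrA.
by congr (F _ + F _ + F _); apply/val_inj.
Qed.

Lemma orient_cycle (a b c : point) :
  (orient b c a = orient a b c) * (orient c a b = orient a b c).
Proof. by split; rewrite /orient; ring. Qed.

Lemma peval_bary3 v x : let D := orient (v 0) (v 1) (v 2) in
  [/\ peval (bary v 0) x = orient x (v 1) (v 2) / D,
      peval (bary v 1) x = orient x (v 2) (v 0) / D
    & peval (bary v 2) x = orient x (v 0) (v 1) / D].
Proof.
move=> D; split; rewrite peval_bary.
- have -> : (0 + 1 : 'I_3) = 1 by apply/val_inj.
  by have -> : (0 + 2 : 'I_3) = 2 by apply/val_inj.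
- have -> : (1 + 1 : 'I_3) = 2 by apply/val_inj.
  have -> : (1 + 2 : 'I_3) = 0 by apply/val_inj.
  by rewrite (orient_cycle (v 0) (v 1) (v 2)).
- have -> : (2 + 1 : 'I_3) = 0 by apply/val_inj.
  have -> : (2 + 2 : 'I_3) = 1 by apply/val_inj.
  by rewrite (orient_cycle (v 0) (v 1) (v 2)).
Qed.

Lemma sum_bary v x : is_triangle v -> \sum_i peval (bary v i) x = 1.
Proof.
rewrite /is_triangle => v0.
rewrite sum3E; case: (peval_bary3 v x) => -> -> ->.
by move: v0; rewrite /orient => v0; field.
Qed.

Lemma sum_bary_vertices v x : is_triangle v ->
  \sum_i peval (bary v i) x *: v i = x.
Proof.
rewrite /is_triangle => v0.
rewrite sum3E; case: (peval_bary3 v x) => -> -> ->.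
case: x (v 0) (v 1) (v 2) v0 => x y [a1 a2] [b1 b2] [c1 c2].
rewrite /orient /= => v0; congr pair; rewrite /= /GRing.scale /=; field; exact: v0.
Qed.

Lemma poly_inf_roots (S : idomainType) (q : {poly S}) (f : nat -> S) :
  injective f -> (forall n, root q (f n)) -> q = 0.
Proof.
move=> fI fq; apply/eqP; apply: contraT => /max_poly_roots q0.
have := q0 [seq f n | n <- iota 0 (size q)].
rewrite map_inj_uniq // iota_uniq size_map size_iota ltnn.
by apply=> //; apply/allP => _ /mapP[n _ ->].
Qed.

Lemma peval_inj0 p : (forall x, peval p x = 0) -> p = 0.
Proof.
move=> p0.
pose h (i : 'I_2) : {poly {poly R}} := if i == 0 then 'X else 'X%:P.
pose P := mmap (polyC \o polyC) h p.
have PE : P = \sum_(m <- msupp p) (mcoeff m p)%:P%:P * ('X^(m 0) * ('X^(m 1))%:P).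
  rewrite /P /mmap; apply: eq_bigr => m _ /=; congr (_ * _).
  rewrite /mmap1 !big_ord_recl big_ord0 mulr1 /h /=.
  rewrite [lift _ _](_ : _ = 1); last exact/val_inj.
  by rewrite rmorphXn /=; congr ('X^(m _) * _); apply/val_inj.
have ev x y : P.[x%:P].[y] = peval p (x, y).
  rewrite PE /peval mevalE !horner_sum; apply: eq_bigr => m _.
  rewrite !(hornerM, hornerC, hornerXn, horner_exp).
  rewrite !big_ord_recl big_ord0 mulr1 /=.
  rewrite [lift _ _](_ : _ = 1); last exact/val_inj.
  by congr (_ * (_ ^+ m _ * _)); apply/val_inj.
have natI : injective (fun n => n%:R : R) by move=> a b /eqP; rewrite eqr_nat => /eqP.
have P0 : P = 0.
  apply: (@poly_inf_roots _ _ (fun n => (n%:R : R)%:P)).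
    by move=> a b /polyC_inj /natI.
  move=> a; apply/eqP; apply: (poly_inf_roots natI) => b; apply/eqP.
  by rewrite ev p0.
apply/mpolyP => m; rewrite mcoeff0.
have := congr1 (fun q : {poly {poly R}} => q`_(m 0)`_(m 1)) P0.
rewrite /= !coef0 PE !coef_sum => sum0.
have [mp|/memN_msupp_eq0 //] := boolP (m \in msupp p).
rewrite -{}sum0 (bigD1_seq m) //= ?msupp_uniq // big1 ?addr0.
  by rewrite coefCM coefMC coefXn eqxx mul1r coefCM coefXn eqxx mulr1.
move=> m' m'm; rewrite coefCM coefMC coefXn coefCM.
case: eqP => [e0|]; last by rewrite mul0r coef0 mulr0.
rewrite mul1r coefXn; case: eqP => [e1|]; last by rewrite mulr0.
case/eqP: m'm; apply/mnmP => -[[|[|//]] i] //.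
- by rewrite (_ : Ordinal i = 0) ?e0 //; apply/val_inj.
- by rewrite (_ : Ordinal i = 1) ?e1 //; apply/val_inj.
Qed.

Lemma restrict_triangle_inj v p q : is_triangle v ->
  peval p \_ (triangle v) = peval q \_ (triangle v) -> p = q.
Proof.
move=> v0 pq.
have {pq} : forall x, triangle v x -> peval (p - q) x = 0.
  move=> x Tx; have := congr1 (@^~ x) pq.
  by rewrite /patch mem_set // /peval mevalB => ->; rewrite subrr.
move: (p - q) (subr0_eq (V := poly2) (x := p) (y := q)) => r rpq r0; apply: rpq.
apply: peval_inj0 => x.
pose c := \sum_i 3%:R^-1 *: v i.
pose h (i : 'I_2) : {poly R} :=
  if i == 0 then c.1%:P + (x.1 - c.1) *: 'X else c.2%:P + (x.2 - c.2) *: 'X.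
pose g := mmap (@polyC R) h r.
have ev t : g.[t] = peval r (c + t *: (x - c)).
  rewrite /g /mmap /peval mevalE horner_sum; apply: eq_bigr => m _.
  rewrite hornerM hornerC horner_prod; congr (_ * _); apply: eq_bigr => i _.
  rewrite horner_exp /h; congr (_ ^+ _).
  by case: (i == 0); rewrite hornerD hornerC hornerZ hornerX /= mulrC.
suff g0 : g = 0 by rewrite (_ : x = c + 1 *: (x - c)) -?ev ?g0 ?horner0 // scale1r addrC subrK.
pose M : R := 1 + \sum_i 3%:R * `|peval (bary v i) x|.
have nn i : true -> 0 <= 3 * `|peval (bary v i) x| by rewrite mulr_ge0.
have Mb i : 1 + 3%:R * `|peval (bary v i) x| <= M.
  by rewrite lerD2l (bigD1 i) //= lerDl sumr_ge0 // => j _; apply: nn.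
have M0 : 0 < M by apply: (lt_le_trans ltr01); rewrite lerDl sumr_ge0.
apply: (@poly_inf_roots _ _ (fun n => (M + n%:R)^-1)).
  by move=> a b /invr_inj /addrI /eqP; rewrite eqr_nat => /eqP.
move=> n; apply/eqP; rewrite ev r0 //.
have Mn : 0 < M + n%:R by rewrite ltr_wpDr.
set t := _^-1; have t0 : 0 <= t by rewrite invr_ge0 ltW.
exists (fun i => (1 - t) / 3%:R + t * peval (bary v i) x); split.
- move=> i; have : t * (1 + 3%:R * `|peval (bary v i) x|) <= 1.
    rewrite mulrC ler_pdivrMr // mul1r (le_trans (Mb i)) // lerDl //.
  have : - (t * `|peval (bary v i) x|) <= t * peval (bary v i) x.
    by rewrite -mulrN ler_wpM2l // lerNl -normrN ler_norm.
  by move: (t * peval _ _) (`| _ |) => a b; lra.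
- rewrite big_split /= -[X in _ + X]mulr_sumr sum_bary // mulr1 sum3E.
  by field.
- under eq_bigr do rewrite scalerDl -!scalerA.
  rewrite big_split /= -!scaler_sumr sum_bary_vertices //.
  by rewrite scalerBl scale1r scalerBr scaler_sumr -/c addrA addrAC.
Qed.

End Checks.

(* Main.v *)
Require Import Defs.
From HB Require Import structures.
From mathcomp Require Import all_boot all_order all_algebra.
From mathcomp Require Import all_classical all_reals all_analysis.
From mathcomp Require Import zify ring lra.

Set Implicit Arguments.
Unset Strict Implicit.
Unset Printing Implicit Defensive.

Import Order.TTheory GRing.Theory Num.Theory.
Import numFieldNormedType.Exports.

Local Open Scope classical_set_scope.
Local Open Scope ring_scope.

(** Every polynomial of degree at most k is a combination of the Bernstein
    polynomials lambda^alpha with |alpha| = k, and each family of functionals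
    reads off one region of this triangle of coefficients. Below, N and M stand
    for r^v + 1 and r^e + 1.

    At a vertex v_i, lambda^alpha vanishes to the exact order k - alpha_i, so
    the derivatives of order < N vanish only if the coefficients with
    k - alpha_i < N do ([vertex_coef0]): look at the lowest order that occurs.

    Across the edge e_i, lambda^alpha vanishes to the exact order alpha_i. If
    all coefficients with alpha_i < b are zero, the normal derivative of order b
    on e_i is a nonzero multiple of
      sum_(alpha_i = b) c_alpha (1 - t)^(alpha_(i+1)) t^(alpha_(i+2))
    ([normal_derivative_on_edge]). As the vertex coefficients are already known
    to vanish, both exponents are at least N - b, so that this is
    ((1 - t) t)^(N - b) W(t) with W of degree at most k - 2 N + b: W is an
    admissible test function, and testing against it gives W = 0, that is, the
    coefficients of the row alpha_i = b vanish ([edge_coef0]). By induction on b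
    this holds for all b < M.

    What is left of u lies in the bubble space; testing u against itself gives
    u = 0 ([dofs_determine]).

    For the dimension, the same regions partition the indices alpha
    ([card_bernstein_regions]): k >= 2 r^v + 1 keeps the three vertex regions
    apart, and r^v >= 2 r^e puts the intersection of two edge strips inside a
    vertex region. A vertex region has as many indices as there are derivatives
    of order < N, and the row of order b of an edge has k + 1 + b - 2 N of them,
    the dimension of the space of test functions. *)

(** * Bases and dimension *)

Section LinearAlgebra.
Variables (R : realType) (V : lmodType R).

Lemma linspan_seqP (s : seq V) x : linspan [set` s] x ->
  exists c : 'I_(size s) -> R, x = \sum_i c i *: s`_i.
Proof.
case=> n [c] [g] [gs ->].
have gi i : (index (g i) s < size s)%N by rewrite index_mem; apply: gs.
exists (fun j => \sum_(i < n | Ordinal (gi i) == j) c i).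
under [RHS]eq_bigr do rewrite scaler_suml.
rewrite (exchange_big_dep predT) //=; apply: eq_bigr => i _.
by rewrite (big_pred1 (Ordinal (gi i))) /= ?nth_index //; apply: gs.
Qed.

Lemma linspan_mem (S : set V) x : S x -> linspan S x.
Proof.
move=> Sx; exists 1%N, (fun=> 1), (fun=> x); split=> //.
by rewrite big_ord1 scale1r.
Qed.

Lemma linspan_sum (S : set V) (I : finType) (A : pred I) (c : I -> R)
    (g : I -> V) : (forall i, A i -> S (g i)) ->
  linspan S (\sum_(i | A i) c i *: g i).
Proof.
move=> gS; rewrite -big_enum.
have [/eqP A0|] := posnP (size (enum A)).
  exists 0%N, (fun=> 0), (fun=> 0); split; first by case.
  by rewrite (size0nil (eqP A0)) big_nil big_ord0.
case E : (enum A) => [//|i0 s] _; rewrite -E big_tnth.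
exists (size (enum A)), (fun j => c (tnth (in_tuple (enum A)) j)),
  (fun j => g (tnth (in_tuple (enum A)) j)); split=> // j.
by apply: gS; have := mem_tnth j (in_tuple (enum A)); rewrite mem_enum.
Qed.

(** If [s] were longer than [t], the matrix of the coordinates of [s] in [t]
    would have more rows than columns; a linear relation between its rows is one
    between the vectors of [s]. *)
Lemma lin_free_size_le (s t : seq V) :
  lin_free s -> (forall x, x \in s -> linspan [set` t] x) ->
  (size s <= size t)%N.
Proof.
move=> sfree st.
have /choice[a aE] : forall i : 'I_(size s), exists c : 'I_(size t) -> R,
    s`_i = \sum_j c j *: t`_j.
  by move=> i; apply/linspan_seqP/st/mem_nth.
pose A := \matrix_(i < size s, j < size t) a i j.
rewrite leqNgt; apply/negP => ts.
have : kermx A != 0.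
  rewrite -mxrank_eq0 mxrank_ker subn_eq0 -ltnNge.
  exact: leq_ltn_trans (rank_leq_col _) ts.
case/rowV0Pn => u /sub_kermxP uA /eqP; apply.
apply/rowP => i; rewrite mxE; apply: sfree i.
under eq_bigr => i _ do rewrite aE scaler_sumr.
rewrite exchange_big /= big1 // => j _.
under eq_bigr do rewrite scalerA.
rewrite -scaler_suml; have := congr1 (fun B : 'rV_(size t) => B 0 j) uA.
rewrite !mxE => uA0; rewrite (_ : \sum_i _ = 0) ?scale0r // -[RHS]uA0.
by apply: eq_bigr => i _; rewrite mxE.
Qed.

Lemma is_basis_size (P : set V) (s t : seq V) :
  is_basis P s -> is_basis P t -> size s = size t.
Proof.
move=> [sf sP] [tf tP]; apply/eqP; rewrite eqn_leq.
by apply/andP; split; apply: lin_free_size_le => // x xs;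
  [rewrite tP -sP|rewrite sP -tP]; apply: linspan_mem.
Qed.

Lemma is_basis_family (I : finType) (A : {pred I}) (f : I -> V) :
  (forall c : I -> R,
     \sum_(i in A) c i *: f i = 0 -> forall i, i \in A -> c i = 0) ->
  is_basis (linspan [set w | exists2 i, i \in A & w = f i])
           [seq f i | i <- enum A].
Proof.
move=> ffree; split; last first.
  congr linspan; apply/seteqP; split=> w /=.
    by move=> /mapP[i]; rewrite mem_enum => iA ->; exists i.
  by move=> [i iA ->]; apply/map_f; rewrite mem_enum.
rewrite /lin_free size_map -(cardE A) => c.
under eq_bigr => j _ do
  rewrite (nth_map (enum_default j)) -?cardE // -[nth _ _ _]/(enum_val j).
move=> c0 j.
have [i0 i0A] : exists i, i \in A by exists (enum_val j); apply: enum_valP.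
pose c' i := c (enum_rank_in i0A i).
rewrite -[j](enum_valK_in i0A) -/(c' _); apply: ffree; last exact: enum_valP.
rewrite -[RHS]c0.
rewrite (reindex_onto (enum_val : 'I_#|A| -> I) (enum_rank_in i0A)) /=;
  last first.
  by move=> i iA; rewrite enum_rankK_in.
apply: eq_big => [l|l _]; first by rewrite enum_valP enum_valK_in eqxx.
by rewrite /c' enum_valK_in.
Qed.

End LinearAlgebra.

(** * Polynomials along a line, and their degrees *)

Section Rays.
Variable R : realType.
Local Notation point := (R * R)%type.
Local Notation poly2 := (mpoly 2 R).
Implicit Types (p q : poly2) (x d : point).

Definition pcoord x (i : 'I_2) : R := if i == 0 then x.1 else x.2.

Lemma forall_I2 (P : 'I_2 -> Prop) : P 0 -> P 1 -> forall i, P i.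
Proof.
move=> P0 P1 [[|[|//]] i]; [move: P0|move: P1]; congr (P _); exact: val_inj.
Qed.

Lemma sum_I2 (V : nmodType) (F : 'I_2 -> V) : \sum_i F i = F 0 + F 1.
Proof.
rewrite !big_ord_recl big_ord0 addr0.
by congr (F _ + F _); apply/val_inj.
Qed.

Lemma prod_I2 (S : comRingType) (F : 'I_2 -> S) : \prod_i F i = F 0 * F 1.
Proof.
rewrite !big_ord_recl big_ord0 mulr1.
by congr (F _ * F _); apply/val_inj.
Qed.

(** The polynomial tau |-> p (x + tau d). Directional derivatives of [p] at [x]
    become coefficients of a univariate polynomial. *)
Definition ray x d p : {poly R} :=
  mmap (@polyC R) (fun i => (pcoord x i)%:P + pcoord d i *: 'X) p.

Lemma rayD x d : {morph ray x d : p q / p + q}. Proof. exact: mmapD. Qed.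
Lemma rayZ x d c p : ray x d (c *: p) = c *: ray x d p.
Proof. by rewrite /ray mmapZ mul_polyC. Qed.
Lemma ray0 x d : ray x d 0 = 0. Proof. exact: mmap0. Qed.
Lemma rayM x d : {morph ray x d : p q / p * q}. Proof. exact: rmorphM. Qed.
Lemma rayC x d c : ray x d (mpolyC 2 c) = c%:P. Proof. exact: mmapC. Qed.
Lemma rayXU x d i :
  ray x d (mpolyX R (mnm1 i)) = (pcoord x i)%:P + pcoord d i *: 'X.
Proof. by rewrite /ray mmapX mmap1U. Qed.
Lemma rayXn x d n : {morph ray x d : p / p ^+ n}. Proof. exact: rmorphXn. Qed.

Lemma ray_horner x d p t : (ray x d p).[t] = peval p (x + t *: d).
Proof.
rewrite /ray /mmap /peval mevalE horner_sum; apply: eq_bigr => m _.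
rewrite hornerM hornerC horner_prod; congr (_ * _); apply: eq_bigr => i _.
rewrite horner_exp /pcoord; congr (_ ^+ _).
by case: (i == 0); rewrite hornerD hornerC hornerZ hornerX /= mulrC.
Qed.

Lemma poly2_ind (P : poly2 -> Prop) :
  (forall c, P (mpolyC 2 c)) -> (forall i, P (mpolyX R (mnm1 i))) ->
  (forall p q, P p -> P q -> P (p + q)) ->
  (forall p q, P p -> P q -> P (p * q)) -> forall p, P p.
Proof.
move=> PC PX PD PM p; rewrite (mpolyE p).
apply: (big_ind P) => [|p1 p2|m _].
- by rewrite -(mpolyC0 2); apply: PC.
- exact: PD.
rewrite -mul_mpolyC; apply: (PM); first exact: PC.
rewrite mpolyXE_id; apply: (big_ind P) => [|p1 p2|i _].
- by rewrite -mpolyC1; apply: PC.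
- exact: PM.
elim: (m i) => [|n IH]; first by rewrite expr0 -mpolyC1; apply: (PC).
by rewrite exprS; apply: (PM).
Qed.

Lemma dirderivM d p q :
  dirderiv d (p * q) = dirderiv d p * q + p * dirderiv d q.
Proof.
rewrite /dirderiv !mderivM mulrDl mulrDr !scalerDr.
by rewrite -!scalerAl -!scalerAr addrACA.
Qed.

Lemma ray_dirderiv x d p : ray x d (dirderiv d p) = (ray x d p)^`().
Proof.
elim/poly2_ind: p => [c|i|p q IHp IHq|p q IHp IHq].
- by rewrite /dirderiv !mderivC !scaler0 addr0 ray0 rayC derivC.
- rewrite /dirderiv !mderivX rayD !rayZ rayXU derivD derivC add0r derivZ derivX.
  move: i; apply: forall_I2; rewrite !mnmE /= scale0r scaler0 ?addr0 ?add0r.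
    rewrite scale1r; congr (_ *: _).
    by rewrite (_ : mnm_sub _ _ = @mnm0 2) ?mpolyX0 ?rayC //;
       apply/mnmP => j; rewrite !mnmE subnn.
  rewrite scale1r; congr (_ *: _).
  by rewrite (_ : mnm_sub _ _ = @mnm0 2) ?mpolyX0 ?rayC //;
     apply/mnmP => j; rewrite !mnmE subnn.
- have -> : dirderiv d (p + q) = dirderiv d p + dirderiv d q.
    by rewrite /dirderiv !mderivD !scalerDr addrACA.
  by rewrite rayD IHp IHq (rayD _ _ p) derivD.
- by rewrite dirderivM rayD !rayM derivM IHp IHq.
Qed.

Lemma ray_iter_dirderiv x d p n :
  ray x d (iter n (dirderiv d) p) = (ray x d p)^`(n).
Proof.
by elim: n => [//|n IH]; rewrite iterS ray_dirderiv IH derivnS.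
Qed.

Lemma peval_iter_dirderiv x d p n :
  peval (iter n (dirderiv d) p) x = (ray x d p)`_n *+ n`!.
Proof.
have := ray_horner x d (iter n (dirderiv d) p) 0.
rewrite scale0r addr0 => <-; rewrite ray_iter_dirderiv horner_coef0.
by rewrite coef_derivn addn0 ffactnn.
Qed.

(** The coefficient of order n of a ray is a combination of the partial
    derivatives of total order n; this is how the conditions at a vertex reach
    the rays that leave it. *)
Lemma ray_coef_low x d p N :
  (forall m : multinom 2, (mdeg m < N)%N -> peval (mderivm m p) x = 0) ->
  forall n, (n < N)%N -> (ray x d p)`_n = 0.
Proof.
move=> p0 n nN; have : forall m : multinom 2, (mdeg m + n < N)%N ->
    peval (mderivm m (iter n (dirderiv d) p)) x = 0.
  elim: n {nN} => [|n IH] m mnN; first by rewrite p0 // -(addn0 (mdeg m)).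
  rewrite iterS {1}/dirderiv mderivmD !mderivmZ -!mderivmU1m -!mderivmDm.
  rewrite /peval mevalD !mevalZ.
  by rewrite -/(peval _ x) IH -/(peval _ x) ?IH ?mulr0 ?addr0 // mdegD mdeg1;
    move: mnN; lia.
move=> /(_ (@mnm0 2)); rewrite mdeg0 add0n mderivm0m => /(_ nN).
rewrite peval_iter_dirderiv => /eqP; rewrite -mulr_natr mulf_eq0 pnatr_eq0.
by rewrite (gtn_eqF (fact_gt0 n)) orbF => /eqP.
Qed.

Lemma polysM (j l : int) p q :
  polys j p -> polys l q -> polys (j + l) (p * q).
Proof.
move=> pj ql m /msuppM_le /allpairsP[[m1 m2] [/= /pj ? /ql ? ->]].
by rewrite mdegD PoszD lerD.
Qed.

Lemma polysD (j : int) p q : polys j p -> polys j q -> polys j (p + q).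
Proof.
by move=> pj qj m /msuppD_le; rewrite mem_cat => /orP[/pj|/qj].
Qed.

Lemma polys0 (j : int) : polys j (0 : poly2).
Proof. by move=> m; rewrite -[0](mpolyC0 2) msupp0. Qed.

Lemma polysC c : polys 0 (mpolyC 2 c : poly2).
Proof.
move=> m; rewrite msuppC; case: ifP => //.
by rewrite inE => _ /eqP ->; rewrite mdeg0.
Qed.

Lemma polysZ (j : int) c p : polys j p -> polys j (c *: p).
Proof. by move=> pj m /msuppZ_le /pj. Qed.

Lemma polysXU i : polys 1 (mpolyX R (mnm1 i) : poly2).
Proof. by move=> m; rewrite msuppX inE => /eqP ->; rewrite mdeg1. Qed.

Lemma polysX (n : nat) p : polys 1 p -> polys n%:Z (p ^+ n).
Proof.
move=> p1; elim: n => [|n IH]; first by rewrite expr0 -mpolyC1; apply: polysC.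
by rewrite exprS intS; apply: polysM.
Qed.

Lemma polys_sum (j : int) I (r : seq I) (P : pred I) (F : I -> poly2) :
  (forall i, P i -> polys j (F i)) -> polys j (\sum_(i <- r | P i) F i).
Proof. by move=> ?; apply: big_ind => //; [apply: polys0|apply: polysD]. Qed.

Lemma polys_le (j l : int) p : j <= l -> polys j p -> polys l p.
Proof. by move=> jl pj m /pj /le_trans; apply. Qed.

Lemma size_ray x d p n : polys (n%:Z - 1) p -> (size (ray x d p) <= n)%N.
Proof.
move=> pn; rewrite /ray /mmap.
apply: (leq_trans (size_sum _ _ _)); apply/bigmax_leqP_seq => m /pn mn _.
have {mn} mn : (mdeg m < n)%N by move: mn; lia.
rewrite mul_polyC (leq_trans (size_scale_leq _ _)) //.
rewrite /mmap1 prod_I2.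
have {}mn : (m 0%R + m 1%R < n)%N by move: mn; rewrite mdegE sum_I2.
have sz i : (size (((pcoord x i)%:P + pcoord d i *: 'X) ^+ m i) <= (m i).+1)%N.
  apply: (leq_trans (size_poly_exp_leq _ _)).
  set s := size _; have : (s <= 2)%N.
    rewrite (leq_trans (size_polyD _ _)) // geq_max.
    rewrite (leq_trans (size_polyC_leq1 _)) //.
    by rewrite (leq_trans (size_scale_leq _ _)) // size_polyX.
  by case: s => [|[|[|//]]] _ /=; rewrite ?mul0n ?mul1n.
have := sz 0; have := sz 1; set a := (_ ^+ m 0); set b := (_ ^+ m 1) => sb sa.
apply: (leq_trans (size_polyMleq _ _)).
by move: sa sb mn; move: (size a) (size b) (m 0%R) (m 1%R) => A B M N; lia.
Qed.

End Rays.

(** * Barycentric coordinates and the Bernstein basis *)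

Section Bernstein.
Variable R : realType.
Local Notation point := (R * R)%type.
Local Notation poly2 := (mpoly 2 R).
Implicit Types (p q u : poly2) (x d : point) (v : 'I_3 -> point).

Lemma forall_I3 (P : 'I_3 -> Prop) : P 0 -> P 1 -> P 2 -> forall i, P i.
Proof.
move=> P0 P1 P2 [[|[|[|//]]] i]; [move: P0|move: P1|move: P2];
  congr (P _); exact: val_inj.
Qed.

(** Indices are written relatively to a vertex or edge i, as i, i + 1, i + 2
    modulo 3; this is what makes one proof serve for the three of them. *)
Lemma I3_cycle : ((0 + 1)%R = 1 :> 'I_3) * ((0 + 2)%R = 2 :> 'I_3) *
  ((1 + 1)%R = 2 :> 'I_3) * ((1 + 2)%R = 0 :> 'I_3) *
  ((2 + 1)%R = 0 :> 'I_3) * ((2 + 2)%R = 1 :> 'I_3).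
Proof. by do !split; apply/val_inj. Qed.

Lemma sum_I3 (V : nmodType) (F : 'I_3 -> V) i :
  \sum_j F j = F i + F (i + 1) + F (i + 2).
Proof.
rewrite sum3E.
move: i; apply: forall_I3; rewrite ?I3_cycle //.
  by rewrite -addrA addrC.
by rewrite [RHS]addrC addrA [RHS]addrC [RHS]addrCA -addrA [RHS]addrCA.
Qed.

Lemma prod_I3 (S : comRingType) (F : 'I_3 -> S) i :
  \prod_j F j = F i * F (i + 1) * F (i + 2).
Proof.
have -> : \prod_j F j = F 0 * F 1 * F 2.
  rewrite !big_ord_recl big_ord0 mulr1 mulrA.
  by congr (F _ * F _ * F _); apply/val_inj.
by move: i; apply: forall_I3; rewrite ?I3_cycle; ring.
Qed.

Lemma I3_cases i j : [\/ j = i, j = i + 1 | j = i + 2 :> 'I_3].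
Proof.
move: i; apply: forall_I3; move: j; apply: forall_I3;
  rewrite ?I3_cycle; by [constructor 1|constructor 2|constructor 3].
Qed.

Lemma I3_neq (i : 'I_3) : (i + 1 == i) = false /\
  (i + 2 == i) = false /\ (i + 2 == i + 1) = false.
Proof. by move: i; apply: forall_I3. Qed.

Lemma mdeg_I3 (a : multinom 3) i : mdeg a = (a i + a (i + 1)%R + a (i + 2)%R)%N.
Proof. by rewrite mdegE; apply: (sum_I3 a i). Qed.

Lemma poly2_eq p q : (forall x, peval p x = peval q x) -> p = q.
Proof.
move=> pq; apply/subr0_eq/peval_inj0 => x.
by rewrite /peval mevalB -/(peval p x) pq subrr.
Qed.

Lemma pevalD p q x : peval (p + q) x = peval p x + peval q x.
Proof. exact: mevalD. Qed.
Lemma pevalZ c p x : peval (c *: p) x = c * peval p x.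
Proof. exact: mevalZ. Qed.
Lemma pevalM p q x : peval (p * q) x = peval p x * peval q x.
Proof. exact: mevalM. Qed.
Lemma pevalXn p n x : peval (p ^+ n) x = peval p x ^+ n.
Proof. exact: rmorphXn. Qed.
Lemma pevalXU i x : peval (mpolyX R (mnm1 i)) x = pcoord x i.
Proof. exact: mevalXU. Qed.
Lemma pevalC c x : peval (mpolyC 2 c) x = c.
Proof. exact: mevalC. Qed.
Lemma peval_sum I (r : seq I) (P : pred I) (F : I -> poly2) x :
  peval (\sum_(i <- r | P i) F i) x = \sum_(i <- r | P i) peval (F i) x.
Proof. exact: raddf_sum. Qed.

Lemma peval_bary_comb v (l : 'I_3 -> R) j : is_triangle v -> \sum_i l i = 1 ->
  peval (bary v j) (\sum_i l i *: v i) = l j.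
Proof.
move=> v0; rewrite !(sum_I3 _ 0) !I3_cycle => l1.
have {l1} -> : l = fun i => if i == 0 then 1 - l 1 - l 2 else l i.
  by apply/funext; apply: forall_I3 => //=; rewrite -l1; ring.
move: v0; rewrite /= /is_triangle => v0.
set x := (X in peval _ X); have [E0 E1 E2] := peval_bary3 v x.
rewrite {}/x in E0 E1 E2 *.
move: j; apply: forall_I3; rewrite ?(E0, E1, E2) /=.
all: by move: v0; rewrite /orient /GRing.scale /= /GRing.scale /= => v0; field.
Qed.

(** The derivative of the affine function [bary v j] in the direction [d]. *)
Definition bary_slope v (j : 'I_3) d : R :=
  (orient (v j) (v (j + 1)) (v (j + 2)))^-1 *
  (((v (j + 1)).2 - (v (j + 2)).2) * d.1
   + ((v (j + 2)).1 - (v (j + 1)).1) * d.2).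

Lemma bary_slopeE v j x d :
  bary_slope v j d = peval (bary v j) (x + d) - peval (bary v j) x.
Proof.
rewrite /bary !pevalZ !pevalD !pevalZ !pevalC !pevalXU.
by rewrite /bary_slope /pcoord /=; ring.
Qed.

Lemma ray_bary v j x d :
  ray x d (bary v j) = (peval (bary v j) x)%:P + bary_slope v j d *: 'X.
Proof.
rewrite /bary rayZ !rayD !rayZ rayC !rayXU !pevalZ !pevalD !pevalZ !pevalC.
rewrite !pevalXU /pcoord /bary_slope /=; set D := _^-1.
apply/polyP => n; rewrite !(coefD, coefZ, coefC, coefX).
by case: n => [|[|n]] /=; ring.
Qed.

Definition bernstein v (a : multinom 3) : poly2 :=
  \prod_(i < 3) bary v i ^+ a i.

Lemma polys_bary v i : polys 1 (bary v i).
Proof.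
apply: polysZ; apply: polysD; last exact/polysZ/polysXU.
apply: polysD; last exact/polysZ/polysXU.
exact: (polys_le _ (@polysC _ _)).
Qed.

Lemma polys_bernstein v a : polys (mdeg a)%:Z (bernstein v a).
Proof.
rewrite /bernstein (prod_I3 _ 0) (mdeg_I3 a 0) !PoszD.
by do 2?apply: polysM; apply/polysX/polys_bary.
Qed.

(** Homogenization: expressing 1 and the two coordinates as linear forms in the
    barycentric coordinates turns each monomial of degree at most k, completed
    by powers of 1, into a form of degree k in these coordinates. *)
Lemma bernstein_span v k u : is_triangle v -> polys k%:Z u ->
  exists c : bmultinom 3 k.+1 -> R,
    u = \sum_(a | mdeg (bmnm a) == k) c a *: bernstein v (bmnm a).
Proof.
move=> v0 uk.
(* [X], [Y], [S] are the linear forms that stand for x_1, x_2 and 1. *)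
pose lin (f : 'I_3 -> R) : mpoly 3 R := \sum_i f i *: mpolyX R (mnm1 i).
pose t := [tuple bary v i | i < 3].
pose X := lin (fun i => (v i).1); pose Y := lin (fun i => (v i).2).
pose S := lin (fun=> 1).
have homl f : lin f \in ishomog1 1 mdeg.
  by apply: rpred_sum => i _; apply: rpredZ; rewrite dhomogX; apply/eqP/mdeg1.
have compl f : comp_mpoly t (lin f) = \sum_i f i *: bary v i.
  rewrite raddf_sum; apply: eq_bigr => i _.
  by rewrite /= comp_mpolyZ comp_mpolyXU -tnth_nth tnth_mktuple.
have XE : comp_mpoly t X = mpolyX R (mnm1 0).
  rewrite compl; apply: poly2_eq => x; rewrite peval_sum pevalXU /pcoord /=.
  rewrite -[in RHS](sum_bary_vertices x v0) raddf_sum; apply: eq_bigr => i _.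
  by rewrite pevalZ mulrC.
have YE : comp_mpoly t Y = mpolyX R (mnm1 1).
  rewrite compl; apply: poly2_eq => x; rewrite peval_sum pevalXU /pcoord /=.
  rewrite -[in RHS](sum_bary_vertices x v0) raddf_sum; apply: eq_bigr => i _.
  by rewrite pevalZ mulrC.
have SE : comp_mpoly t S = 1.
  rewrite compl; apply: poly2_eq => x; rewrite peval_sum -mpolyC1 pevalC.
  rewrite -[in RHS](sum_bary x v0); apply: eq_bigr => i _.
  by rewrite pevalZ mul1r.
pose U := \sum_(m <- msupp u) mcoeff m u *:
  (X ^+ m 0 * Y ^+ m 1 * S ^+ (k - mdeg m)).
have UE : comp_mpoly t U = u.
  rewrite [RHS](mpolyE u) raddf_sum; apply: eq_bigr => m _.
  rewrite /= comp_mpolyZ !rmorphM !rmorphXn /= XE YE SE expr1n mulr1.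
  by rewrite [in RHS]mpolyXE_id prod_I2.
have Uhom : U \in ishomog1 k mdeg.
  rewrite /U big_seq; apply: rpred_sum => m /uk mk; apply: rpredZ.
  have {mk} mk : (mdeg m <= k)%N by [].
  have kE : k = (1 * m 0%R + 1 * m 1%R + 1 * (k - mdeg m))%N.
    have md : mdeg m = (m 0%R + m 1%R)%N by rewrite mdegE sum_I2.
    by rewrite !mul1n -md subnKC.
  have : X ^+ m 0 * Y ^+ m 1 * S ^+ (k - mdeg m) \is
      ishomog1 (1 * m 0%R + 1 * m 1%R + 1 * (k - mdeg m))%N mdeg.
    by do 2?apply: dhomogM; apply: dhomogMn; apply: homl.
  by rewrite -kE.
exists (fun a => mcoeff (bmnm a) U).
rewrite -[LHS]UE [in LHS](mpolywE (k := k.+1) (p := U)).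
  rewrite raddf_sum /= (bigID (fun a => mdeg (bmnm a) == k)) /=.
  rewrite [X in _ + X]big1 ?addr0 => [|a ak]; last first.
    by rewrite (dhomog_nemf_coeff Uhom ak) scale0r raddf0.
  apply: eq_bigr => a _; rewrite comp_mpolyZ comp_mpolyX; congr (_ *: _).
  by rewrite /bernstein; apply: eq_bigr => i _; rewrite tnth_mktuple.
rewrite msizeE; apply/bigmax_leqP_seq => m mU _.
by rewrite ltnS (dhomog_mf Uhom mU).
Qed.

End Bernstein.

(** * Reading Bernstein coefficients at vertices and on edges *)

Section Coefficients.
Variable R : realType.
Local Notation point := (R * R)%type.
Local Notation poly2 := (mpoly 2 R).
Implicit Types (p q u : poly2) (x d : point) (v : 'I_3 -> point).

(** If all the terms of order below n are absent, the coefficient of order n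
    sees nothing of a cofactor B but its value at 0. *)
Lemma coef_low (I : finType) (S : pred I) (e : I -> nat) (c : I -> R)
    (B : I -> {poly R}) n :
  (forall i, S i -> (e i < n)%N -> c i = 0) ->
  (\sum_(i | S i) c i *: (B i * 'X^(e i)))`_n =
  \sum_(i | S i && (e i == n)) c i * (B i).[0].
Proof.
move=> c0; rewrite coef_sum big_mkcondr /=; apply: eq_bigr => i Si.
rewrite coefZ coefMXn horner_coef0.
case: (ltngtP (e i) n) => [/(c0 _ Si) ->|//|<-]; first by rewrite mul0r.
  by rewrite mulr0.
by rewrite subnn.
Qed.

Lemma monomials_free (I : finType) (S : pred I) (e : I -> nat) (c : I -> R)
    (f : nat -> R) : {in S &, injective e} -> injective f ->
  (forall n, \sum_(i | S i) c i * f n ^+ e i = 0) ->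
  forall i, S i -> c i = 0.
Proof.
move=> eI fI c0 i Si.
have p0 : \sum_(j | S j) c j *: 'X^(e j) = 0 :> {poly R}.
  apply: (poly_inf_roots fI) => n; apply/eqP; rewrite horner_sum -[RHS](c0 n).
  by apply: eq_bigr => j _; rewrite hornerZ hornerXn.
have := congr1 (fun p : {poly R} => p`_(e i)) p0.
rewrite coef0 coef_sum (bigD1 i) //= big1 ?addr0 => [|j /andP[Sj ji]].
  by rewrite coefZ coefXn eqxx mulr1.
rewrite coefZ coefXn; case: eqP => [/(eI _ _ Si Sj) ij|]; last by rewrite mulr0.
by rewrite ij eqxx in ji.
Qed.

Lemma bary_vertex v i j : is_triangle v -> peval (bary v j) (v i) = (j == i)%:R.
Proof.
move=> v0; rewrite -(peval_bary_comb (l := fun j => (j == i)%:R) j v0).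
  congr (peval _ _); rewrite (bigD1 i) //= eqxx scale1r big1 ?addr0 // => l.
  by move=> /negbTE ->; rewrite scale0r.
by rewrite (bigD1 i) //= eqxx big1 ?addr0 // => l /negbTE ->.
Qed.

Lemma ray_bernstein v a i x d : ray x d (bernstein v a) =
  ray x d (bary v i) ^+ a i * ray x d (bary v (i + 1)) ^+ a (i + 1) *
  ray x d (bary v (i + 2)) ^+ a (i + 2).
Proof. by rewrite /bernstein (prod_I3 _ i) !rayM !rayXn. Qed.

Lemma ray_sum x d I (r : seq I) (P : pred I) (F : I -> poly2) :
  ray x d (\sum_(i <- r | P i) F i) = \sum_(i <- r | P i) ray x d (F i).
Proof. exact: raddf_sum. Qed.

Variables (v : 'I_3 -> point) (k : nat).
Hypothesis v0 : is_triangle v.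

Definition bcomb (c : bmultinom 3 k.+1 -> R) : poly2 :=
  \sum_(a | mdeg (bmnm a) == k) c a *: bernstein v (bmnm a).

Lemma bmultinom3_inj (i : 'I_3) (a b : bmultinom 3 k.+1) :
  mdeg (bmnm a) = k -> mdeg (bmnm b) = k ->
  bmnm a i = bmnm b i -> bmnm a (i + 2) = bmnm b (i + 2) -> a = b.
Proof.
move=> ak bk ab0 ab2; apply: val_inj; apply/mnmP => j /=.
have ab1 : bmnm a (i + 1) = bmnm b (i + 1).
  by move: ak bk; rewrite (mdeg_I3 _ i) (mdeg_I3 (bmnm b) i); lia.
by case: (I3_cases i j) => ->.
Qed.

(** On the ray with direction (v_(i+1) - v_i) + t (v_(i+2) - v_i), lambda^a is
    tau^(k - a_i) t^(a_(i+2)) (1 - (1 + t) tau)^(a_i). Once the coefficients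
    with k - a_i < n vanish, the coefficient of tau^n is therefore a polynomial
    in t whose coefficients are those c_a with k - a_i = n. *)
Lemma vertex_coef0 c i N :
  (forall m : multinom 2, (mdeg m < N)%N ->
     peval (mderivm m (bcomb c)) (v i) = 0) ->
  forall a, mdeg (bmnm a) = k -> (k < bmnm a i + N)%N -> c a = 0.
Proof.
move=> u0.
have [i1 [i2 i12]] := I3_neq i.
have sl t (j : 'I_3) :
    bary_slope v j (v (i + 1) - v i + t *: (v (i + 2) - v i)) =
    (if j == i then - (1 + t) else if j == i + 1 then 1 else t).
  rewrite (bary_slopeE v j (v i)) bary_vertex //.
  pose l (j : 'I_3) := if j == i then - t else if j == i + 1 then 1 else t.
  rewrite [X in peval _ X](_ : _ = \sum_j l j *: v j); last first.
    rewrite (sum_I3 _ i) /l eqxx i1 eqxx i2 i12.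
    apply: injective_projections; rewrite /GRing.scale /= /GRing.scale /=;
      ring.
  rewrite peval_bary_comb //; last first.
    by rewrite (sum_I3 _ i) /l eqxx i1 eqxx i2 i12; ring.
  case: (I3_cases i j) => ->; rewrite /l ?eqxx ?i1 ?i2 ?i12 /=; ring.
have key n : (n < N)%N -> forall a, mdeg (bmnm a) = k ->
    (bmnm a (i + 1)%R + bmnm a (i + 2)%R)%N = n -> c a = 0.
  elim/ltn_ind: n => n IH nN a ak an.
  pose T (b : bmultinom 3 k.+1) := (mdeg (bmnm b) == k) &&
    (bmnm b (i + 1)%R + bmnm b (i + 2)%R == n)%N.
  apply: (@monomials_free _ T (fun b => bmnm b (i + 2)) c (fun n => n%:R)).
  - move=> b b' /andP[/eqP bk /eqP bn] /andP[/eqP bk' /eqP bn'] e.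
    apply: (@bmultinom3_inj i) => //.
    by move: bk bk'; rewrite (mdeg_I3 _ i) (mdeg_I3 (bmnm b') i); lia.
  - by move=> m m' /eqP; rewrite eqr_nat => /eqP.
  - move=> m; set t : R := m%:R.
    have := ray_coef_low (v (i + 1) - v i + t *: (v (i + 2) - v i)) u0 nN.
    rewrite ray_sum => u0n; rewrite -[RHS]u0n.
    pose B (b : bmultinom 3 k.+1) : {poly R} :=
      (1 - (1 + t) *: 'X) ^+ bmnm b i * (t ^+ bmnm b (i + 2))%:P.
    under [in RHS]eq_bigr => b _.
      rewrite rayZ (ray_bernstein _ _ i) !ray_bary !sl !bary_vertex //.
      rewrite !eqxx i1 i2 i12 !add0r scale1r exprZn scaleNr.
      rewrite (_ : _ * _ = B b * 'X^(bmnm b (i + 1)%R + bmnm b (i + 2)%R)).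
        over.
      by rewrite /B exprD -!mul_polyC /= mulr1n; ring.
    rewrite coef_low => [|b /eqP bk bn]; last first.
      by apply: (IH _ bn) => //; apply: ltn_trans nN.
    apply: eq_bigr => b _; rewrite /B hornerM hornerC horner_exp.
    rewrite !(hornerD, hornerN, hornerZ, hornerX, hornerC).
    by rewrite mulr0 subr0 expr1n mul1r.
  - by rewrite /T ak an !eqxx.
move=> a ak; have := mdeg_I3 (bmnm a) i; rewrite ak => kE an.
by apply: (key (bmnm a (i + 1)%R + bmnm a (i + 2)%R)%N) => //; lia.
Qed.

(** A vertex sees all the coefficients when all the derivatives are used. *)
Lemma bernstein_free c : bcomb c = 0 -> forall a, mdeg (bmnm a) = k -> c a = 0.
Proof.
move=> c0 a ak; apply: (@vertex_coef0 c 0 k.+1) => //.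
  by move=> m _; rewrite c0 raddf0 /peval raddf0.
by rewrite ltn_addl.
Qed.

Definition edge_pt (i : 'I_3) (t : R) : point :=
  edge_src v i + t *: (edge_tgt v i - edge_src v i).

Lemma bary_edge_pt i t : [/\ peval (bary v i) (edge_pt i t) = 0,
  peval (bary v (i + 1)) (edge_pt i t) = 1 - t &
  peval (bary v (i + 2)) (edge_pt i t) = t].
Proof.
have [i1 [i2 i12]] := I3_neq i.
pose l (j : 'I_3) := if j == i then 0 else if j == i + 1 then 1 - t else t.
rewrite (_ : edge_pt i t = \sum_j l j *: v j); last first.
  rewrite (sum_I3 _ i) /l eqxx i1 eqxx i2 i12 /edge_pt /edge_src /edge_tgt.
  apply: injective_projections; rewrite /GRing.scale /= /GRing.scale /=;
    ring.
have l1 : \sum_j l j = 1.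
  by rewrite (sum_I3 _ i) /l eqxx i1 eqxx i2 i12; ring.
by split; rewrite peval_bary_comb // /l ?eqxx ?i1 ?i2 ?i12.
Qed.

(** Along a line crossing the edge at its point of parameter t, lambda_i is a
    multiple of the parameter tau, while lambda_(i+1) and lambda_(i+2) start
    with 1 - t and t. So lambda^a starts with tau^(a_i), and once the indices
    with a_i < b are gone, those with a_i = b alone contribute to tau^b. *)
Lemma normal_derivative_on_edge c i b d t :
  (forall a, mdeg (bmnm a) = k -> (bmnm a i < b)%N -> c a = 0) ->
  peval (iter b (dirderiv d) (bcomb c)) (edge_pt i t) =
  (bary_slope v i d ^+ b *
   \sum_(a | (mdeg (bmnm a) == k) && (bmnm a i == b))
      c a * ((1 - t) ^+ bmnm a (i + 1) * t ^+ bmnm a (i + 2))) *+ b`!.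
Proof.
move=> c0; rewrite peval_iter_dirderiv; congr (_ *+ _).
rewrite ray_sum; have [e0 e1 e2] := bary_edge_pt i t.
pose B (a : bmultinom 3 k.+1) : {poly R} := (bary_slope v i d ^+ bmnm a i)%:P *
   (((1 - t)%:P + bary_slope v (i + 1) d *: 'X) ^+ bmnm a (i + 1) *
    (t%:P + bary_slope v (i + 2) d *: 'X) ^+ bmnm a (i + 2)).
under eq_bigr => a _.
  rewrite rayZ (ray_bernstein _ _ i) !ray_bary e0 e1 e2 add0r exprZn.
  rewrite (_ : _ * _ = B a * 'X^(bmnm a i)); first over.
  by rewrite /B -mul_polyC; ring.
rewrite coef_low => [|a /eqP]; last exact: c0.
rewrite mulr_sumr; apply: eq_bigr => a /andP[_ /eqP ab].
rewrite /B ab !(hornerM, hornerC, horner_exp, hornerD, hornerZ, hornerX).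
by rewrite !mulr0 !addr0; ring.
Qed.

(** Homogeneity of degree L in (1 - t, t) makes it possible to divide by
    (1 - t)^L and to take the ratio t / (1 - t), here 1, 2, 3, ..., as the
    variable. *)
Lemma edge_monomials_free (T : pred (bmultinom 3 k.+1))
    (c : bmultinom 3 k.+1 -> R) (e e' : bmultinom 3 k.+1 -> nat) L :
  {in T &, injective e'} -> (forall a, T a -> c a != 0 -> (e a + e' a)%N = L) ->
  (forall t : R, 0 < t < 1 ->
     \sum_(a | T a) c a * ((1 - t) ^+ e a * t ^+ e' a) = 0) ->
  forall a, T a -> c a = 0.
Proof.
move=> e'I eM c0; apply: (@monomials_free _ T e' c (fun n => n.+1%:R)) => //.
  by move=> m n /eqP; rewrite eqr_nat eqSS => /eqP.
move=> n; pose t : R := n.+1%:R / n.+2%:R.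
have n2 : (n.+2%:R : R) != 0 by rewrite pnatr_eq0.
have tE : 1 - t = n.+2%:R^-1.
  by rewrite /t -[n.+2]addn1 natrD in n2 *; field.
have : 0 < t < 1.
  by rewrite divr_gt0 ?ltr0Sn //= ltr_pdivrMr ?ltr0Sn // mul1r ltr_nat.
move=> /c0 s0; have := congr1 (fun x : R => n.+2%:R ^+ L * x) s0.
rewrite mulr0 mulr_sumr => s1; rewrite -[RHS]s1.
apply: eq_bigr => a Ta.
have [->|ca] := eqVneq (c a) 0; first by rewrite !mul0r mulr0.
rewrite -(eM a Ta ca) tE /t exprMn exprD !exprVn.
by move: (n.+1%:R) (n.+2%:R) n2 => y x x0; field; rewrite !expf_neq0.
Qed.

(** A direction that is orthogonal to the edge and along which lambda_i is
    constant would be zero. *)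
Lemma normal_slope_neq0 i d : unit_normal v i d -> bary_slope v i d != 0.
Proof.
have D0 : orient (v i) (v (i + 1)) (v (i + 2)) != 0.
  suff -> : orient (v i) (v (i + 1)) (v (i + 2)) = orient (v 0) (v 1) (v 2).
    exact: v0.
  move: i; apply: forall_I3; rewrite !I3_cycle; first reflexivity.
    by rewrite (orient_cycle (v 0) (v 1) (v 2)).
  by rewrite (orient_cycle (v 0) (v 1) (v 2)).
move=> [dn n1]; rewrite mulf_neq0 ?invr_eq0 //; apply/eqP => s0.
have n2 : d.1 ^+ 2 + d.2 ^+ 2 = 1.
  have := congr1 (fun y : R => y ^+ 2) n1.
  rewrite /euclid_norm sqr_sqrtr ?expr1n //.
  by rewrite addr_ge0 ?sqr_ge0.
move: dn D0 s0; rewrite /edge_tgt /edge_src /=.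
move: (v i) (v (i + 1)) (v (i + 2)) n2 => [a1 a2] [b1 b2] [c1 c2] /=.
case: d n1 => d1 d2 /= _ n2 dn D0 s0; case/eqP: D0; rewrite /orient /=.
have e1 : c1 - b1 = 0.
  have -> : c1 - b1 = d1 * (d1 * (c1 - b1) + d2 * (c2 - b2))
    + d2 * ((b2 - c2) * d1 + (c1 - b1) * d2)
    + (c1 - b1) * (1 - (d1 ^+ 2 + d2 ^+ 2)) by ring.
  by rewrite dn s0 n2; ring.
have e2 : c2 - b2 = 0.
  have -> : c2 - b2 = d2 * (d1 * (c1 - b1) + d2 * (c2 - b2))
    - d1 * ((b2 - c2) * d1 + (c1 - b1) * d2)
    + (c2 - b2) * (1 - (d1 ^+ 2 + d2 ^+ 2)) by ring.
  by rewrite dn s0 n2; ring.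
by rewrite (subr0_eq e1) (subr0_eq e2); ring.
Qed.

End Coefficients.

(** * Integration of polynomials *)

Section Positivity.
Context d (T : measurableType d) (R : realType)
  (mu : {measure set T -> \bar R}).

(** Positivity of the integral is reduced to the measure of one set on which the
    integrand is bounded below; integrability excludes the value +oo, of which
    the real-valued integral would be 0. *)
Lemma Rintegral_gt0 (D B : set T) (f : T -> R) (e : R) :
  measurable D -> measurable B -> B `<=` D -> (0 < mu B)%E ->
  mu.-integrable D (EFin \o f) -> (forall x, D x -> 0 <= f x) ->
  0 < e -> (forall x, B x -> e <= f x) -> 0 < \int[mu]_(x in D) f x.
Proof.
move=> mD mB BD B0 fi f0 e0 ef.
have mf := measurable_int mu fi.
rewrite /Rintegral fine_gt0 //; apply/andP; split; last first.
  by have := integrable_fin_num mD fi; rewrite ge0_fin_numE //;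
     apply: integral_ge0 => x Dx; rewrite lee_fin f0.
have : (e%:E * mu B <= \int[mu]_(x in D) (f x)%:E)%E.
  rewrite -integral_cst //.
  apply: (@le_trans _ _ (\int[mu]_(x in B) (f x)%:E)%E).
    apply: ge0_le_integral => //=.
    + by move=> x _; rewrite lee_fin ltW.
    + exact: measurable_funS mf.
  by apply: ge0_subset_integral => // x Dx; rewrite lee_fin f0.
by apply: lt_le_trans; rewrite mule_gt0 ?lte_fin.
Qed.

Lemma Rintegral_sum (D : set T) n (c : 'I_n -> R) (f : 'I_n -> T -> R) :
  measurable D -> (forall i, mu.-integrable D (EFin \o f i)) ->
  mu.-integrable D (EFin \o (fun x => \sum_i c i * f i x)) /\
  \int[mu]_(x in D) (\sum_i c i * f i x) = \sum_i c i * \int[mu]_(x in D) f i x.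
Proof.
move=> mD fi; elim: n c f fi => [|n IH] c f fi.
  rewrite big_ord0 [X in _ /\ X = _](_ : _ = \int[mu]_(x in D) 0); last first.
    by apply: eq_Rintegral => x _; rewrite big_ord0.
  rewrite /Rintegral integral0; split=> //.
  rewrite (_ : _ \o _ = cst 0%E); first exact: integrable0.
  by apply/funext => x /=; rewrite big_ord0.
have [gi gE] := IH (fun i => c (lift ord0 i)) (fun i => f (lift ord0 i))
  (fun i => fi (lift ord0 i)).
have f0i : mu.-integrable D (EFin \o (fun x => c ord0 * f ord0 x)).
  by have := integrableZl mD (c ord0) (fi ord0).
have E : (fun x => \sum_i c i * f i x) = (fun x => c ord0 * f ord0 x +
    \sum_(i < n) c (lift ord0 i) * f (lift ord0 i) x).
  by apply/funext => x; rewrite big_ord_recl.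
rewrite E big_ord_recl -gE; split; last by rewrite RintegralD // RintegralZl.
by have := integrableD mD f0i gi.
Qed.

End Positivity.

Section OneDim.
Variable R : realType.
Local Notation mu := (@lebesgue_measure R).

Lemma lebesgue_itv_gt0 (a b : R) : a < b -> (0 < mu `]a, b[%classic)%E.
Proof.
move=> ab; rewrite lebesgue_measure_itv /= lte_fin ifT //.
by rewrite -EFinB lte_fin subr_gt0.
Qed.

Lemma lebesgue_segment_ltoo (a b : R) : (mu `[a, b]%classic < +oo)%E.
Proof. by rewrite lebesgue_measure_itv /=; case: ifP => _; rewrite ?ltry. Qed.

Lemma horner_integrable (p : {poly R}) :
  mu.-integrable `[0, 1] (EFin \o horner p).
Proof.
apply: continuous_compact_integrable; first exact: segment_compact.
exact/continuous_subspaceT/continuous_horner.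
Qed.

Lemma horner_integral_eq0 (p : {poly R}) :
  (forall t, 0 <= t <= 1 -> 0 <= p.[t]) ->
  \int[mu]_(t in `[0, 1]) p.[t] = 0 -> p = 0.
Proof.
move=> p0 ip; apply: contrapT => pn0.
(* The points 1 / (n + 2) are infinitely many and interior to [0, 1]. *)
have [n pn] : exists n, p.[n.+2%:R^-1] != 0.
  apply: contrapT => /forallNP np; apply: pn0.
  apply: (@poly_inf_roots _ _ (fun n => n.+2%:R^-1)).
    by move=> a b /invr_inj /eqP; rewrite eqr_nat !eqSS => /eqP.
  by move=> n; have /negP := np n; rewrite negbK.
set t0 := _^-1 in pn.
have t01 : 0 < t0 < 1 by rewrite invr_gt0 ltr0Sn invf_lt1 ?ltr0Sn // ltr1n.
have pt0 : p.[t0] / 2 < p.[t0].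
  have : 0 < p.[t0].
    by rewrite lt_neqAle eq_sym pn p0 // !ltW //; case/andP: t01.
  lra.
have : \forall t \near t0, p.[t0] / 2 < p.[t] /\ 0 < t < 1.
  near=> t; split.
    by near: t; apply: cvgr_gt pt0; exact: continuous_horner.
  apply/andP; split; near: t.
    by apply: (cvgr_gt t0) => //; case/andP: t01.
  by apply: (cvgr_lt t0) => //; case/andP: t01.
case/nbhs_ballP => e /= e0 eB.
have : 0 < \int[mu]_(t in `[0, 1]) p.[t].
  apply: (@Rintegral_gt0 _ (measurableTypeR R) R mu _
    `]t0 - e, t0 + e[%classic (horner p) (p.[t0] / 2)) => //.
  - move=> t /=; rewrite in_itv /= => te.
    have /eB[_] : ball t0 e t.
      rewrite /ball /= ltr_norml; move: te => /andP[? ?].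
      by apply/andP; split; lra.
    by rewrite in_itv /= => /andP[? ?]; rewrite !ltW.
  - by apply: lebesgue_itv_gt0; lra.
  - exact: horner_integrable.
  - rewrite divr_gt0 //; lra.
  - move=> t /=; rewrite in_itv /= => te.
    have /eB[/ltW] : ball t0 e t; last by [].
    rewrite /ball /= ltr_norml; move: te => /andP[? ?].
    by apply/andP; split; lra.
by rewrite ip ltxx.
Unshelve. all: by end_near.
Qed.

End OneDim.

Section TwoDim.
Variable R : realType.
Local Notation point := (R * R)%type.
Local Notation poly2 := (mpoly 2 R).
Local Notation mu := (@lebesgue_measure R).
Local Notation mu2 := (mu \x mu)%E.
Implicit Types (p q u : poly2) (x d : point) (v : 'I_3 -> point).

Lemma measurable_peval p : measurable_fun [set: point] (peval p).
Proof.
elim/poly2_ind: p => [c|i|p q IHp IHq|p q IHp IHq].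
- by rewrite (_ : peval _ = cst c) //; apply/funext => x; rewrite pevalC.
- rewrite (_ : peval _ = fun x => pcoord x i); last first.
    by apply/funext => x; rewrite pevalXU.
  by move: i; apply: forall_I2; [exact: measurable_fst|exact: measurable_snd].
- rewrite (_ : peval _ = peval p \+ peval q); last first.
    by apply/funext => x; rewrite pevalD.
  exact: measurable_realfun.measurable_funD.
- rewrite (_ : peval _ = peval p \* peval q); last first.
    by apply/funext => x; rewrite pevalM.
  exact: measurable_realfun.measurable_funM.
Qed.

Lemma continuous_peval p : continuous (peval p).
Proof.
elim/poly2_ind: p => [c|i|p q IHp IHq|p q IHp IHq].
- rewrite (_ : peval _ = cst c); first exact: cst_continuous.
  by apply/funext => x; rewrite pevalC.
- rewrite (_ : peval _ = fun x => pcoord x i); last first.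
    by apply/funext => x; rewrite pevalXU.
  by move: i; apply: forall_I2 => x; [exact: cvg_fst|exact: cvg_snd].
- rewrite (_ : peval _ = peval p \+ peval q); last first.
    by apply/funext => x; rewrite pevalD.
  by move=> x; apply: cvgD; [apply: IHp|apply: IHq].
- rewrite (_ : peval _ = peval p \* peval q); last first.
    by apply/funext => x; rewrite pevalM.
  by move=> x; apply: cvgM; [apply: IHp|apply: IHq].
Qed.

Lemma box_gt0 (a b c d : R) : a < b -> c < d ->
  (0 < mu2 (`]a, b[%classic `*` `]c, d[%classic))%E.
Proof.
move=> ab cd; rewrite product_measure1E // mule_gt0 //;
  exact: lebesgue_itv_gt0.
Qed.

Variable v : 'I_3 -> point.
Hypothesis v0 : is_triangle v.

Lemma triangleP x : triangle v x <-> forall i, 0 <= peval (bary v i) x.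
Proof.
split=> [[l [l0 l1 ->]] i|b0]; first by rewrite peval_bary_comb.
exists (fun i => peval (bary v i) x); split=> //; first exact: sum_bary.
by rewrite sum_bary_vertices.
Qed.

Lemma measurable_triangle : measurable (triangle v).
Proof.
have -> : triangle v =
    \bigcap_(i in [set: 'I_3]) (peval (bary v i) @^-1` `[0, +oo[).
  apply/seteqP; split=> x.
    by move=> /triangleP b0 i _ /=; rewrite in_itv /= andbT.
  move=> b0; apply/triangleP => i; have := b0 i I.
  by rewrite /= in_itv /= andbT.
apply: fin_bigcap_measurable => // i _.
by rewrite -[X in measurable X]setTI; apply: measurable_peval.
Qed.

Lemma bounded_peval p : exists M, forall x, triangle v x -> `|peval p x| <= M.
Proof.
elim/poly2_ind: p => [c|i|p q [M IHp] [N IHq]|p q [M IHp] [N IHq]].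
- by exists `|c| => x _; rewrite pevalC.
- exists (\sum_j `|pcoord (v j) i|) => x [l [l0 l1 ->]].
  rewrite pevalXU.
  have -> : pcoord (\sum_j l j *: v j) i = \sum_j l j * pcoord (v j) i.
    by rewrite /pcoord; case: ifP => _; rewrite raddf_sum.
  apply: (le_trans (ler_norm_sum _ _ _)); apply: ler_sum => j _.
  rewrite normrM ger0_norm // ler_piMl //.
  by rewrite -l1 (bigD1 j) //= lerDl sumr_ge0.
- exists (M + N) => x xT; rewrite pevalD (le_trans (ler_normD _ _)) //.
  by rewrite lerD ?IHp ?IHq.
- by exists (M * N) => x xT; rewrite pevalM normrM ler_pM ?IHp ?IHq.
Qed.

Lemma triangle_finite : (mu2 (triangle v) < +oo)%E.
Proof.
have [M MP] := bounded_peval (mpolyX R (mnm1 0)).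
have [N NP] := bounded_peval (mpolyX R (mnm1 1)).
apply: (@le_lt_trans _ _ (mu2 (`[- M, M]%classic `*` `[- N, N]%classic))).
  apply: le_measure; rewrite ?inE.
  - exact: measurable_triangle.
  - exact: measurableX.
  - move=> x xT; have := MP x xT; have := NP x xT; rewrite !pevalXU /pcoord /=.
    by rewrite !ler_norml /= !in_itv.
rewrite product_measure1E // lte_mul_pinfty ?measure_ge0 //.
- by rewrite ge0_fin_numE ?measure_ge0 //; apply: lebesgue_segment_ltoo.
- exact: lebesgue_segment_ltoo.
Qed.

Lemma triangle_integrable p : mu2.-integrable (triangle v) (EFin \o peval p).
Proof.
apply: measurable_bounded_integrable.
- exact: measurable_triangle.
- exact: triangle_finite.
- by apply: measurable_funS (measurable_peval p).
- have [M MP] := bounded_peval p; exists M; split; first exact: num_real.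
  by move=> N MN x xT /=; rewrite (le_trans (MP x xT)) // ltW.
Qed.

(** If [p] is not zero, it does not vanish at some interior point of the
    triangle: otherwise its restrictions to the lines through the centroid would
    have infinitely many roots. It is then bounded below on a box around that
    point. *)
Lemma triangle_integral_eq0 p : (forall x, 0 <= peval p x) ->
  triangle_integral v (peval p) = 0 -> p = 0.
Proof.
move=> p0 ip; apply: contrapT => pn0.
have [x [xint px]] : exists x,
    (forall i, 0 < peval (bary v i) x) /\ peval p x != 0.
  apply: contrapT => /forallNP np; apply/pn0/peval_inj0 => x.
  pose c := \sum_i 3%:R^-1 *: v i.
  have cb i : peval (bary v i) c = 3%:R^-1.
    by rewrite peval_bary_comb // sum3E; field.
  have near_i i : \forall t \near (0 : R),
      0 < peval (bary v i) (c + t *: (x - c)).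
    have E t : peval (bary v i) (c + t *: (x - c)) =
        (ray c (x - c) (bary v i)).[t].
      by rewrite ray_horner.
    near=> t; rewrite E; near: t.
    apply: (cvgr_gt (ray c (x - c) (bary v i)).[0]).
      exact: continuous_horner.
    by rewrite -E scale0r addr0 cb invr_gt0.
  have : \forall t \near (0 : R), forall i,
      0 < peval (bary v i) (c + t *: (x - c)).
    by near=> t; apply: forall_I3; near: t; apply: near_i.
  case/nbhs_ballP => e /= e0 eB.
  have r0 : ray c (x - c) p = 0.
    apply: (@poly_inf_roots _ _ (fun n => e / n.+2%:R)).
      move=> a b /(mulfI (lt0r_neq0 e0)) /invr_inj /eqP.
      by rewrite eqr_nat !eqSS => /eqP.
    move=> n; have /eB b0 : ball 0 e (e / n.+2%:R : R).
      rewrite /ball /= sub0r normrN gtr0_norm ?divr_gt0 //.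
      by rewrite ltr_pdivrMr // ltr_pMr // ltr1n.
    rewrite /root ray_horner; have := np (c + (e / n.+2%:R) *: (x - c)).
    by apply: contra_notT => p1; split.
  have := ray_horner c (x - c) p 1.
  by rewrite r0 horner0 scale1r addrC subrK.
have px0 : peval p x / 2 < peval p x.
  have : 0 < peval p x by rewrite lt_neqAle eq_sym px p0.
  lra.
have : \forall y \near x,
    peval p x / 2 < peval p y /\ forall i, 0 < peval (bary v i) y.
  near=> y; split.
    by near: y; apply: cvgr_gt px0; exact: continuous_peval.
  apply: forall_I3; near: y; (apply: cvgr_gt (xint _); exact: continuous_peval).
case/nbhs_ballP => e /= e0 eB.
have inb y : (`]x.1 - e, x.1 + e[%classic `*`
    `]x.2 - e, x.2 + e[%classic) y -> ball x e y.
  move=> [] /=; rewrite !in_itv /= => /andP[? ?] /andP[? ?].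
  by split; rewrite /ball /= ltr_norml; apply/andP; split; lra.
have : 0 < triangle_integral v (peval p).
  apply: (@Rintegral_gt0 _ _ R mu2 (triangle v)
    (`]x.1 - e, x.1 + e[%classic `*` `]x.2 - e, x.2 + e[%classic)
    (peval p) (peval p x / 2)) => //.
  - exact: measurable_triangle.
  - exact: measurableX.
  - by move=> y /inb/eB[_ yi]; apply/triangleP => i; rewrite ltW.
  - by apply: box_gt0; lra.
  - exact: triangle_integrable.
  - rewrite divr_gt0 //; lra.
  - by move=> y /inb/eB[/ltW].
by rewrite ip ltxx.
Unshelve. all: by end_near.
Qed.

End TwoDim.

(** * Moments on an edge *)

Section EdgeMoments.
Variable R : realType.
Local Notation point := (R * R)%type.
Local Notation poly2 := (mpoly 2 R).
Local Notation mu := (@lebesgue_measure R).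
Implicit Types (p q u : poly2) (x d : point).
Variable v : 'I_3 -> point.
Hypothesis v0 : is_triangle v.

Lemma edge_length_gt0 i : 0 < euclid_norm (edge_tgt v i - edge_src v i).
Proof.
rewrite sqrtr_gt0 lt_neqAle eq_sym addr_ge0 ?sqr_ge0 // andbT.
rewrite paddr_eq0 ?sqr_ge0 // !sqrf_eq0; apply/negP => /andP[/eqP d1 /eqP d2].
have [_ i2] := I3_neq i; case: i2 => _ i12.
have := bary_vertex (i + 2) (i + 2) v0.
rewrite (_ : v (i + 2) = v (i + 1)); last first.
  by apply: injective_projections; apply/subr0_eq.
by rewrite bary_vertex // eqxx i12 => /eqP; rewrite eq_sym oner_eq0.
Qed.

Lemma fct_scaleE (a : R) (h : point -> R) x : (a *: h) x = a * h x.
Proof. by []. Qed.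

Lemma edge_ptP i x : edge v i x <-> exists2 t, 0 <= t <= 1 & x = edge_pt v i t.
Proof. by []. Qed.

Lemma peval_edge_pt p i t : peval p (edge_pt v i t) =
  (ray (edge_src v i) (edge_tgt v i - edge_src v i) p).[t].
Proof. by rewrite ray_horner. Qed.

(** The moments against the given basis of the test functions on the edge
    determine the moments against every polynomial of the right degree. *)
Lemma edge_moments_span i (j : int) (s : seq (point -> R)) p q :
  is_basis (polys_on j (edge v i)) s ->
  (forall g, g \in s -> edge_integral v i (fun x => peval p x * g x) = 0) ->
  polys j q ->
  \int[mu]_(t in `[0, 1])
    (peval p (edge_pt v i t) * peval q (edge_pt v i t)) = 0.
Proof.
move=> [_ sE] s0 qj.
have on_edge t : t \in `[0, 1]%classic -> edge_pt v i t \in edge v i.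
  by rewrite !inE /= in_itv /= => t01; apply/edge_ptP; exists t.
have [n [c [g [gs qE]]]] : linspan [set` s] (peval q \_ (edge v i)).
  by rewrite sE; exists q.
have /choice[r rE] : forall l, exists r, g l = peval r \_ (edge v i).
  move=> l; have : polys_on j (edge v i) (g l).
    by rewrite -sE; apply: linspan_mem.
  by case=> r _ ->; exists r.
pose F l t := peval p (edge_pt v i t) * peval (r l) (edge_pt v i t).
have FE l : F l =
    horner (ray (edge_src v i) (edge_tgt v i - edge_src v i) (p * r l)).
  by apply/funext => t; rewrite -peval_edge_pt pevalM.
have F0 l : \int[mu]_(t in `[0, 1]) F l t = 0.
  have := s0 _ (gs l); rewrite /edge_integral => /eqP; rewrite mulf_eq0.
  rewrite gt_eqF ?edge_length_gt0 //= => /eqP I0; rewrite -[RHS]I0.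
  apply: eq_Rintegral => t /on_edge et.
  by rewrite /F rE -/(edge_pt v i t) patchT.
have Fi l : mu.-integrable `[0, 1] (EFin \o F l).
  by rewrite FE; apply: horner_integrable.
have [_] := @Rintegral_sum _ _ _ mu `[0, 1]%classic n c F (measurable_itv _) Fi.
rewrite (_ : \int[mu]_(t in _) \sum_l _ =
  \int[mu]_(t in `[0, 1]) (peval p (edge_pt v i t) * peval q (edge_pt v i t))).
  by move=> ->; rewrite big1 // => l _; rewrite F0 mulr0.
apply: eq_Rintegral => t /on_edge et.
have := congr1 (fun h : point -> R => h (edge_pt v i t)) qE.
rewrite /= patchT // => ->; rewrite fct_sumE mulr_sumr; apply: eq_bigr => l _.
by rewrite fct_scaleE /F rE mulrCA; congr (_ * (_ * _)); rewrite patchT.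
Qed.

(** On the edge, a polynomial is a univariate one in the parameter, which is the
    value of the barycentric coordinate of index i + 2; the powers of this
    coordinate restrict to a basis. *)
Lemma polys_on_basis_size i (N : nat) (s : seq (point -> R)) :
  is_basis (polys_on (N%:Z - 1) (edge v i)) s -> size s = N.
Proof.
move=> sb.
pose f (b : 'I_N) : point -> R := peval (bary v (i + 2) ^+ b) \_ (edge v i).
suff fb : is_basis (polys_on (N%:Z - 1) (edge v i)) [seq f b | b <- enum 'I_N].
  by rewrite (is_basis_size sb fb) size_map size_enum_ord.
have fE b t : 0 <= t <= 1 -> f b (edge_pt v i t) = t ^+ b.
  move=> t01; rewrite /f patchT; last by rewrite inE; apply/edge_ptP; exists t.
  by rewrite pevalXn; case: (bary_edge_pt v0 i t) => _ _ ->.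
have := @is_basis_family R (point -> R) 'I_N (fun=> true) f.
set P := linspan _; rewrite (_ : P = polys_on (N%:Z - 1) (edge v i)).
  apply=> c cf b _.
  apply: (@monomials_free R 'I_N predT (fun b => b : nat) c
            (fun n => n.+1%:R^-1)) => //.
  - by move=> a a' _ _; apply: val_inj.
  - by move=> m n /invr_inj /eqP; rewrite eqr_nat eqSS => /eqP.
  move=> n; have t01 : 0 <= (n.+1%:R^-1 : R) <= 1.
    by rewrite invr_ge0 ler0n invf_le1 ?ltr0Sn // ler1n.
  have := congr1 (fun h : point -> R => h (edge_pt v i n.+1%:R^-1)) cf.
  rewrite /= fct_sumE => cf0; rewrite -[RHS]cf0; apply: eq_bigr => l _.
  by rewrite fct_scaleE fE.
apply/seteqP; split=> w.
  case=> n [c] [g] [gf ->].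
  have /choice[r rE] : forall l, exists b : 'I_N, g l = f b.
    by move=> l; have [b _ ->] := gf l; exists b.
  exists (\sum_l c l *: bary v (i + 2) ^+ r l).
    apply: polys_sum => l _; apply: polysZ.
    have := @polysX R (r l) _ (@polys_bary R v (i + 2)); apply: polys_le.
    by have := ltn_ord (r l); lia.
  apply/funext => x; rewrite fct_sumE /patch; case: ifPn => xe.
    rewrite peval_sum; apply: eq_bigr => l _; rewrite pevalZ.
    by rewrite fct_scaleE rE /f /patch xe.
  by rewrite big1 // => l _; rewrite fct_scaleE rE /f /patch (negbTE xe) mulr0.
case=> q qN ->; set rq := ray (edge_src v i) (edge_tgt v i - edge_src v i) q.
rewrite (_ : _ \_ _ = \sum_(b in 'I_N) rq`_b *: f b).
  by apply: linspan_sum => b _; exists b.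
apply/funext => x; rewrite fct_sumE; have [xe|xe] := pselect (edge v i x).
  have [t t01 ->] := (edge_ptP i x).1 xe.
  rewrite patchT ?inE; last by apply/edge_ptP; exists t.
  rewrite peval_edge_pt -/rq (horner_coef_wide _ (size_ray _ _ qN)).
  by apply: eq_bigr => b _; rewrite /= -fE.
rewrite patchN ?notin_setE // big1 // => b _.
by rewrite fct_scaleE /f patchN ?notin_setE // mulr0.
Qed.

Variable k : nat.

(** The normal derivative of order b on the edge is, up to a nonzero constant,
    ((1 - t) t)^(N - b) W(t), where W is an admissible test function. Its moment
    against W is the integral of a nonnegative function, hence W = 0. *)
Lemma edge_coef0 (c : bmultinom 3 k.+1 -> R) (N b : nat) i d :
  bary_slope v i d != 0 -> (b <= N)%N ->
  (forall l a, mdeg (bmnm a) = k -> (k < bmnm a l + N)%N -> c a = 0) ->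
  (forall a, mdeg (bmnm a) = k -> (bmnm a i < b)%N -> c a = 0) ->
  (forall q, polys (k%:Z - 2 * N%:Z + b%:Z) q ->
     \int[mu]_(t in `[0, 1])
        (peval (iter b (dirderiv d) (bcomb v c)) (edge_pt v i t) *
         peval q (edge_pt v i t)) = 0) ->
  forall a, mdeg (bmnm a) = k -> bmnm a i = b -> c a = 0.
Proof.
move=> g0 bN cv cb cq a ak ab.
(* Restricting to c_a != 0 keeps the truncated subtractions in [e] and [e']
   exact. *)
pose T (a : bmultinom 3 k.+1) :=
  [&& mdeg (bmnm a) == k, bmnm a i == b & c a != 0].
pose e (a : bmultinom 3 k.+1) := (bmnm a (i + 1)%R - (N - b))%N.
pose e' (a : bmultinom 3 k.+1) := (bmnm a (i + 2)%R - (N - b))%N.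
have Tk a' : T a' -> [/\ mdeg (bmnm a') = k, bmnm a' i = b,
    (bmnm a' (i + 1)%R = N - b + e a')%N, (bmnm a' (i + 2)%R = N - b + e' a')%N
    & (e a' + e' a')%N%:Z = k%:Z - 2 * N%:Z + b%:Z].
  case/and3P => /eqP a'k /eqP a'b ca'.
  have h l : (bmnm a' l + N <= k)%N.
    by rewrite leqNgt; apply: contra ca' => /(cv _ _ a'k) ->.
  have := h (i + 1); have := h (i + 2); have := mdeg_I3 (bmnm a') i.
  by rewrite /e /e'; split=> //; lia.
apply: contraTeq isT => ca.
suff /(_ a) : forall a, T a -> c a = 0.
  by rewrite /T ak ab !eqxx ca => /(_ isT)/eqP; rewrite (negbTE ca).
pose q := \sum_(a | T a)
  c a *: (bary v (i + 1) ^+ e a * bary v (i + 2) ^+ e' a).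
have qj : polys (k%:Z - 2 * N%:Z + b%:Z) q.
  apply: polys_sum => a' /Tk[_ _ _ _ <-]; apply: polysZ.
  by rewrite PoszD; apply: polysM; apply/polysX/polys_bary.
pose W : {poly R} := \sum_(a | T a) c a *: ((1 - 'X) ^+ e a * 'X ^+ e' a).
have WE t : W.[t] = \sum_(a | T a) c a * ((1 - t) ^+ e a * t ^+ e' a).
  rewrite horner_sum; apply: eq_bigr => a' _.
  by rewrite hornerZ hornerM !horner_exp hornerD hornerN hornerX hornerC.
have qW t : peval q (edge_pt v i t) = W.[t].
  rewrite WE peval_sum; apply: eq_bigr => a' _.
  by rewrite pevalZ pevalM !pevalXn; case: (bary_edge_pt v0 i t) => _ -> ->.
pose P : {poly R} := ((1 - 'X) * 'X) ^+ (N - b) * W ^+ 2.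
have PE t : P.[t] = ((1 - t) * t) ^+ (N - b) * W.[t] ^+ 2.
  by rewrite /P !(hornerM, horner_exp, hornerD, hornerN, hornerX, hornerC).
have rowE t : \sum_(a | (mdeg (bmnm a) == k) && (bmnm a i == b))
    c a * ((1 - t) ^+ bmnm a (i + 1) * t ^+ bmnm a (i + 2)) =
    ((1 - t) * t) ^+ (N - b) * W.[t].
  rewrite WE mulr_sumr (bigID (fun a => c a != 0)) /= addrC.
  rewrite big1 ?add0r => [|a' /andP[_]]; last first.
    by rewrite negbK => /eqP ->; rewrite mul0r.
  apply: eq_big => [a'|a' Ta']; first by rewrite /T andbA.
  have /Tk[_ _ -> -> _] : T a' by rewrite /T andbA.
  by rewrite !exprD exprMn; ring.
have P0 : P = 0.
  apply: horner_integral_eq0 => [t /andP[t0 t1]|].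
    by rewrite PE mulr_ge0 ?sqr_ge0 // exprn_ge0 // mulr_ge0 // subr_ge0.
  pose K : R := bary_slope v i d ^+ b *+ b`!.
  have K0 : K != 0 by rewrite mulrn_eq0 negb_or -lt0n fact_gt0 expf_neq0.
  suff /eqP : \int[mu]_(t in `[0, 1]) (K * P.[t]) = 0.
    rewrite RintegralZl //; last exact: horner_integrable.
    by rewrite mulf_eq0 (negbTE K0) => /eqP.
  rewrite -[RHS](cq q qj); apply: eq_Rintegral => t _.
  rewrite normal_derivative_on_edge // rowE qW PE /K; ring.
apply: (@edge_monomials_free R k T c e e' (absz (k%:Z - 2 * N%:Z + b%:Z))).
- move=> a1 a2 T1 T2 e12.
  have [k1 b1 _ E1 _] := Tk _ T1; have [k2 b2 _ E2 _] := Tk _ T2.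
  by apply: (@bmultinom3_inj k i) => //; rewrite ?b1 ?b2 // E1 E2 e12.
- by move=> a1 /Tk[_ _ _ _ <-] _.
move=> t /andP[t0 t1]; rewrite -WE.
have := congr1 (fun h : {poly R} => h.[t]) P0; rewrite horner0 PE => /eqP.
rewrite mulf_eq0 !expf_eq0 mulf_eq0 subr_eq0 (gt_eqF t1) (gt_eqF t0) /= andbF.
by move/eqP.
Qed.

End EdgeMoments.

(** * Counting Bernstein indices *)

Section Counting.
Local Open Scope nat_scope.
Variable k : nat.

Lemma card_bij (T T' : finType) (A : {pred T'}) (h : T -> T') : injective h ->
  (forall x, h x \in A) -> (forall a, a \in A -> exists x, h x = a) ->
  #|A| = #|T|.
Proof.
move=> hI hA Ah; rewrite -(card_codom hI); apply: eq_card => a.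
apply/idP/codomP => [/Ah[x <-]|[x ->]]; first by exists x.
exact: hA.
Qed.

Definition mnm3 (i : 'I_3) (a b c : nat) : multinom 3 :=
  Multinom
    [tuple if j == i then a else if j == (i + 1)%R then b else c | j < 3].

(** Meaningful only for a + b + c = k, see [bmkE]. *)
Definition bmk i a b c : bmultinom 3 k.+1 := insubd bm0 (mnm3 i a b c).

Lemma bmkE i a b c : a + b + c = k ->
  [/\ mdeg (bmnm (bmk i a b c)) = k, bmnm (bmk i a b c) i = a,
      bmnm (bmk i a b c) (i + 1)%R = b & bmnm (bmk i a b c) (i + 2)%R = c].
Proof.
move=> abc; have [i1 [i2 i12]] := I3_neq i.
have [Ea Eb Ec] : [/\ mnm3 i a b c i = a, mnm3 i a b c (i + 1)%R = b
    & mnm3 i a b c (i + 2)%R = c].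
  by split; rewrite /mnm3 mnmE ?eqxx ?i1 ?i2 ?i12 ?eqxx.
have dk : mdeg (mnm3 i a b c) = k by rewrite (mdeg_I3 _ i) Ea Eb Ec.
by rewrite /bmk insubdK // unfold_in dk.
Qed.

Definition vertex_region N i : pred (bmultinom 3 k.+1) :=
  fun a => (mdeg (bmnm a) == k) && (k < bmnm a i + N).

Definition edge_row N i b : pred (bmultinom 3 k.+1) :=
  fun a => [&& mdeg (bmnm a) == k, bmnm a i == b,
    bmnm a (i + 1)%R + N <= k & bmnm a (i + 2)%R + N <= k].

Definition bubble_index N M : pred (bmultinom 3 k.+1) :=
  fun a => (mdeg (bmnm a) == k) &&
    [forall i : 'I_3, (bmnm a i + N <= k) && (M <= bmnm a i)].

(** The exponents at the two other vertices are the orders of the derivative in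
    the two variables. *)
Lemma card_vertex_region N i : N <= k.+1 ->
  #|vertex_region N i| = #|{: bmultinom 2 N}|.
Proof.
move=> Nk; pose h (m : bmultinom 2 N) :=
  bmk i (k - mdeg (bmnm m)) (bmnm m 0%R) (bmnm m 1%R).
have d2 (m : multinom 2) : mdeg m = m 0%R + m 1%R by rewrite mdegE sum_I2.
have hE m : [/\ mdeg (bmnm (h m)) = k, bmnm (h m) i = k - mdeg (bmnm m),
    bmnm (h m) (i + 1)%R = bmnm m 0%R & bmnm (h m) (i + 2)%R = bmnm m 1%R].
  by apply: bmkE; have := bmdeg m; rewrite d2; lia.
apply: (@card_bij _ _ _ h).
- move=> m m' hm; apply: val_inj; apply/mnmP; apply: forall_I2 => /=.
    by have [_ _ <- _] := hE m; rewrite hm; have [] := hE m'.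
  by have [_ _ _ <-] := hE m; rewrite hm; have [] := hE m'.
- move=> m; have [hk hi _ _] := hE m.
  by rewrite unfold_in /= hk eqxx hi; have := bmdeg m; lia.
- move=> a /andP[/eqP ak an]; have aE := mdeg_I3 (bmnm a) i.
  pose m := Multinom
    [tuple if j == 0%R then bmnm a (i + 1)%R else bmnm a (i + 2)%R | j < 2].
  have [m0 m1] : m 0%R = bmnm a (i + 1)%R /\ m 1%R = bmnm a (i + 2)%R.
    by rewrite /m !mnmE.
  have mN : mdeg m < N by rewrite d2 m0 m1; lia.
  exists (BMultinom mN); have [hk hi _ h2] := hE (BMultinom mN).
  apply: (@bmultinom3_inj k i) => //; last by rewrite h2.
  by rewrite hi /= d2 m0 m1; lia.
Qed.

Lemma card_edge_row N i b : b <= N -> N + b <= k -> N.*2 <= k.+1 ->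
  #|edge_row N i b| = k.+1 + b - N.*2.
Proof.
move=> bN Nbk N2; rewrite -[RHS]card_ord.
pose h (j : 'I_(k.+1 + b - N.*2)) := bmk i b (N - b + j) (k - N - j).
have hE j : [/\ mdeg (bmnm (h j)) = k, bmnm (h j) i = b,
    bmnm (h j) (i + 1)%R = N - b + j & bmnm (h j) (i + 2)%R = k - N - j].
  by apply: bmkE; have := ltn_ord j; lia.
apply: (@card_bij _ _ _ h).
- move=> j j' hj; apply: val_inj => /=.
  have [_ _ e1 _] := hE j; have [_ _ e2 _] := hE j'.
  by rewrite hj in e1; lia.
- move=> j; have [hk hi h1 h2] := hE j.
  by rewrite unfold_in /= hk hi h1 h2 !eqxx /=; have := ltn_ord j; lia.
- move=> a /and4P[/eqP ak /eqP ab a1 a2]; have aE := mdeg_I3 (bmnm a) i.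
  have jN : bmnm a (i + 1)%R - (N - b) < k.+1 + b - N.*2 by lia.
  exists (Ordinal jN); have [hk hi _ h2] := hE (Ordinal jN).
  by apply: (@bmultinom3_inj k i) => //; rewrite ?hi ?h2 /=; lia.
Qed.

(** At each index, exactly one of the indicator functions of the regions
    is 1. *)
Lemma card_bernstein_regions N M : M.*2 <= N.+1 -> N.*2 <= k.+1 ->
  #|[pred a : bmultinom 3 k.+1 | mdeg (bmnm a) == k]| =
  \sum_(i < 3) #|vertex_region N i| +
  \sum_(i < 3) \sum_(b < M) #|edge_row N i b| +
  #|bubble_index N M|.
Proof.
move=> MN Nk.
have cardE (A : pred (bmultinom 3 k.+1)) :
    (forall a, A a -> mdeg (bmnm a) = k) ->
    #|A| = \sum_(a : bmultinom 3 k.+1 | mdeg (bmnm a) == k) (A a : nat).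
  move=> Ak; rewrite -sum1_card [RHS]big_mkcond [LHS]big_mkcond.
  apply: eq_bigr => a _; rewrite unfold_in.
  by case: (boolP (A a)) => [/Ak ->|]; rewrite ?eqxx // if_same.
have cardV i := cardE (vertex_region N i) (fun a => fun h => eqP (andP h).1).
have cardR i b : #|edge_row N i b| =
    \sum_(a : bmultinom 3 k.+1 | mdeg (bmnm a) == k) (edge_row N i b a : nat).
  by apply: cardE => a /and4P[/eqP].
rewrite -sum1_card (cardE (bubble_index N M)); last by move=> a /andP[/eqP].
under [X in X + _ + _]eq_bigr do rewrite cardV.
under [X in _ + X + _]eq_bigr => i _.
  under eq_bigr do rewrite cardR.
  rewrite exchange_big; over.
rewrite exchange_big [X in _ + X + _]exchange_big -!big_split /=.
apply: eq_bigr => a /eqP ak.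
have row i : \sum_(b < M) (edge_row N i b a : nat) =
   [&& bmnm a i < M, bmnm a (i + 1)%R + N <= k & bmnm a (i + 2)%R + N <= k].
  case: ltnP => aM /=.
    rewrite (bigD1 (Ordinal aM)) //= big1 ?addn0 /edge_row ?ak ?eqxx //= => b.
    move=> ba; rewrite [_ == nat_of_ord b](_ : _ = false) //.
    by apply: contraNF ba => /eqP ba; apply/eqP/val_inj.
  rewrite big1 // => b _; rewrite /edge_row.
  rewrite [_ == nat_of_ord b](_ : _ = false) ?andbF //.
  by apply/eqP => ab; move: aM; rewrite ab leqNgt ltn_ord.
under [X in _ + X + _]eq_bigr do rewrite row.
rewrite !(sum_I3 _ 0%R) /vertex_region /bubble_index ak eqxx /= !I3_cycle.
have -> : [forall i, (bmnm a i + N <= k) && (M <= bmnm a i)] =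
   [&& bmnm a 0%R + N <= k, bmnm a 1%R + N <= k, bmnm a 2%R + N <= k,
       M <= bmnm a 0%R, M <= bmnm a 1%R & M <= bmnm a 2%R].
  apply/forallP/idP => [ai|].
    have /andP[-> ->] := ai 0%R; have /andP[-> ->] := ai 1%R.
    by have /andP[-> ->] := ai 2%R.
  by case/and5P => ? ? ? ? /andP[? ?]; apply: forall_I3; apply/andP.
have := mdeg_I3 (bmnm a) 0%R; rewrite ak !I3_cycle.
move: (bmnm a 0%R) (bmnm a 1%R) (bmnm a 2%R) => x y z kE {ak row}.
change (1 = ((k < x + N) + (k < y + N) + (k < z + N)) +
  ([&& x < M, y + N <= k & z + N <= k] + [&& y < M, z + N <= k & x + N <= k] +
   [&& z < M, x + N <= k & y + N <= k]) +
  [&& x + N <= k, y + N <= k, z + N <= k, M <= x, M <= y & M <= z]).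
rewrite !(leqNgt _ k) !(leqNgt M).
have [xN|xN] := ltnP k (x + N); have [yN|yN] := ltnP k (y + N);
have [zN|zN] := ltnP k (z + N); have [xM|xM] := ltnP x M;
have [yM|yM] := ltnP y M; have [zM|zM] := ltnP z M => //=; lia.
Qed.

End Counting.

(** * Unisolvence *)

Section Unisolvence.
Variable R : realType.
Local Notation point := (R * R)%type.
Local Notation poly2 := (mpoly 2 R).
Variables (v : 'I_3 -> point) (k : nat).
Hypothesis v0 : is_triangle v.

Lemma bernstein_basis (A : pred (bmultinom 3 k.+1)) :
  (forall a, A a -> mdeg (bmnm a) = k) ->
  is_basis (linspan [set w | exists2 a, a \in A & w = bernstein v (bmnm a)])
           [seq bernstein v (bmnm a) | a <- enum A].
Proof.
move=> Ak; apply: (@is_basis_family R _ _ A (fun a => bernstein v (bmnm a))).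
move=> c c0 a aA; pose c' b := if A b then c b else 0.
suff : c' a = 0 by rewrite /c' (_ : A a).
apply: (bernstein_free v0 (k := k) (c := c')); last exact: Ak.
rewrite -[RHS]c0 /bcomb (bigID A) /= addrC.
rewrite big1 ?add0r => [|b /andP[_ /negbTE Ab]].
  apply: eq_big => [b|b /andP[_ Ab]]; last by rewrite /c' Ab.
  by rewrite unfold_in; case: (boolP (A b)) => [/Ak ->|_]; rewrite ?eqxx ?andbF.
by rewrite /c' Ab scale0r.
Qed.

Lemma polys_basis : is_basis (polys k%:Z : set poly2)
  [seq bernstein v (bmnm a) |
     a <- enum [pred a : bmultinom 3 k.+1 | mdeg (bmnm a) == k]].
Proof.
have := @bernstein_basis [pred a | mdeg (bmnm a) == k] (fun a => eqP).
set P := linspan _; rewrite (_ : P = polys k%:Z) //; apply/seteqP; split=> u.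
  case=> n [c] [g] [gP ->]; apply: polys_sum => l _; apply: polysZ.
  have [a /eqP ak ->] := gP l; have := @polys_bernstein R v (bmnm a).
  by rewrite ak; apply.
move=> /(bernstein_span v0)[c ->]; apply: linspan_sum => a ak.
by exists a.
Qed.

Lemma bubble_basis (N M : nat) : is_basis (bubble k (N%:Z - 1) (M%:Z - 1) v)
  [seq bernstein v (bmnm a) | a <- enum (@bubble_index k N M)].
Proof.
have := @bernstein_basis (@bubble_index k N M) (fun a h => eqP (andP h).1).
congr (is_basis (linspan _) _); apply/seteqP; split=> q.
  case=> a /andP[/eqP ak /forallP aNM] ->; exists (bmnm a); split=> // i;
    by have := aNM i; lia.
case=> a [ak aN aM ->]; have ak1 : (mdeg a < k.+1)%N by rewrite ak.
exists (BMultinom ak1) => //; rewrite unfold_in /bubble_index /= ak eqxx /=.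
by apply/forallP => i; have := aN i; have := aM i; lia.
Qed.

Lemma triangle_moments_span (s : seq poly2) (P : set poly2) p q :
  is_basis P s ->
  (forall g, g \in s ->
     triangle_integral v (fun x => peval p x * peval g x) = 0) ->
  P q -> triangle_integral v (peval (p * q)) = 0.
Proof.
move=> [_ sP] s0; rewrite -sP => -[n [c [g [gs ->]]]].
have FE l : (fun x => peval p x * peval (g l) x) = peval (p * g l).
  by apply/funext => x; rewrite pevalM.
have [_] := @Rintegral_sum _ _ _ (lebesgue_measure \x lebesgue_measure)%E
  (triangle v) n c (fun l => peval (p * g l)) (measurable_triangle v0)
  (fun l => triangle_integrable v0 _).
rewrite [in RHS]big1 => [<-|l _].
  apply: eq_Rintegral => x _; rewrite pevalM peval_sum mulr_sumr.
  by apply: eq_bigr => l _; rewrite pevalZ pevalM mulrCA.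
by rewrite -FE [X in _ * X](s0 _ (gs l)) mulr0.
Qed.

Variables (N M : nat) (nu : 'I_3 -> point).
Hypothesis MN : (M.*2 <= N.+1)%N.
Hypothesis Nk : (N.*2 <= k.+1)%N.

(** The test functions range over whole spaces and not over bases, because the
    proof tests with functions made from [u] itself. *)
Lemma dofs_determine (u : poly2) :
  (forall i, unit_normal v i (nu i)) ->
  polys k%:Z u ->
  (forall i (m : multinom 2), (mdeg m < N)%N ->
     peval (mderivm m u) (v i) = 0) ->
  (forall i b, (b < M)%N -> forall q, polys (k%:Z - 2 * N%:Z + b%:Z) q ->
     \int[lebesgue_measure]_(t in `[0, 1])
       (peval (iter b (dirderiv (nu i)) u) (edge_pt v i t) *
        peval q (edge_pt v i t)) = 0) ->
  (forall q, bubble k (N%:Z - 1) (M%:Z - 1) v q ->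
     triangle_integral v (peval (u * q)) = 0) -> u = 0.
Proof.
move=> nuP /(bernstein_span v0)[c uE] uv ue uT.
rewrite -/(bcomb v c) in uE.
have cv l a : mdeg (bmnm a) = k -> (k < bmnm a l + N)%N -> c a = 0.
  by apply: (@vertex_coef0 R v k v0 c l N) => // m mN; rewrite -uE uv.
have ce i b : (b < M)%N ->
    forall a, mdeg (bmnm a) = k -> bmnm a i = b -> c a = 0.
  elim/ltn_ind: b => b IH bM.
  apply: (@edge_coef0 R v v0 k c N b i (nu i)) => //.
  - exact: normal_slope_neq0.
  - lia.
  - by move=> a ak ab; apply: (IH _ ab) => //; apply: ltn_trans bM.
  - by move=> q qj; rewrite -uE ue.
have uB : bubble k (N%:Z - 1) (M%:Z - 1) v u.
  have [_ <-] := bubble_basis N M.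
  rewrite uE /bcomb (bigID (@bubble_index k N M)) /=.
  rewrite [X in _ + X]big1 ?addr0 => [|a /andP[/eqP ak]].
    apply: linspan_sum => a /andP[_ aB] /=.
    by apply/map_f; rewrite mem_enum.
  rewrite /bubble_index ak eqxx /= negb_forall => /existsP[i].
  rewrite negb_and -!ltnNge => /orP[/(cv _ _ ak) ->|aM].
    by rewrite scale0r.
  by rewrite (ce _ _ aM _ ak erefl) scale0r.
have : u * u = 0.
  apply: (triangle_integral_eq0 v0); last exact: uT.
  by move=> x; rewrite pevalM -expr2 sqr_ge0.
by move=> /eqP; rewrite mulf_eq0 orbb => /eqP.
Qed.

End Unisolvence.

Lemma size_edge_dofs (R : realType) (re : int) (v n : 'I_3 -> R * R)
    (bE : 'I_3 -> nat -> seq (R * R -> R)) :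
  size (edge_dofs re v n bE) =
  (\sum_(i < 3) \sum_(b < absz (re + 1)%R) size (bE i b))%N.
Proof.
rewrite size_flatten sumnE !big_map big_allpairs_dep -big_enum /=.
apply: eq_bigr => i _.
rewrite -[X in iota 0 X]subn0 -/(index_iota 0 _) big_mkord.
by apply: eq_bigr => b _; rewrite size_map.
Qed.

Theorem theorem3p7 (R : realType) (re rv : int) (k : nat)
    (v : 'I_3 -> R * R) (nu : 'I_3 -> R * R)
    (bE : 'I_3 -> nat -> seq (R * R -> R)) (bT : seq (mpoly 2 R)) :
  -1 <= re ->
  Num.max (2 * re) (-1) <= rv ->
  2 * rv + 1 <= k%:Z ->
  is_triangle v ->
  (forall i : 'I_3, unit_normal v i (nu i)) ->
  (forall (i : 'I_3) (beta : nat), beta%:Z <= re ->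
     is_basis (polys_on (k%:Z - 2 * (rv + 1) + beta%:Z) (edge v i))
              (bE i beta)) ->
  is_basis (bubble k rv re v) bT ->
  unisolvent (polys k%:Z)
    (vertex_dofs rv v ++ edge_dofs re v nu bE ++ interior_dofs v bT).
Proof.
move=> re1; rewrite ge_max => /andP[re2 rv1] kv v0 nuP bEP bTP.
have [M ME] : exists M : nat, re = M%:Z - 1 by exists (absz (re + 1)); lia.
have [N NE] : exists N : nat, rv = N%:Z - 1 by exists (absz (rv + 1)); lia.
have MN : (M.*2 <= N.+1)%N by lia.
have Nk : (N.*2 <= k.+1)%N by lia.
have absM : absz (re + 1) = M by lia.
have absN : absz (rv + 1) = N by lia.
have {}bEP i b : (b < M)%N ->
    is_basis (polys_on (k%:Z - 2 * N%:Z + b%:Z) (edge v i)) (bE i b).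
  by move=> bM; have := bEP i b; rewrite NE subrK; apply; lia.
rewrite NE ME in bTP.
split.
  exists [seq bernstein v (bmnm a) |
     a <- enum [pred a : bmultinom 3 k.+1 | mdeg (bmnm a) == k]].
  split; first exact: polys_basis.
  rewrite size_map -cardE (card_bernstein_regions MN Nk) !size_cat.
  have -> : size (vertex_dofs rv v) = (3 * #|{: bmultinom 2 N}|)%N.
    by rewrite size_allpairs -!cardE card_ord absN.
  rewrite size_edge_dofs size_map absM.
  rewrite (is_basis_size bTP (bubble_basis k v0 N M)) size_map -cardE addnA.
  congr (_ + _ + _)%N.
    under eq_bigr => i _ do
      rewrite card_vertex_region ?(leq_trans _ Nk) -?addnn ?leq_addr //.
    by rewrite sum_nat_const card_ord.
  apply: eq_bigr => i _; apply: eq_bigr => b _.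
  have bM := ltn_ord b.
  rewrite card_edge_row //; try lia.
  apply/esym/(@polys_on_basis_size _ _ v0 i).
  by have := bEP i b bM; congr (is_basis (polys_on _ _) _); lia.
move=> u uk u0; apply: (dofs_determine v0 MN Nk nuP uk).
- move=> i m mN; rewrite -absN in mN.
  apply: (u0 (fun u => peval (mderivm (bmnm (BMultinom mN)) u) (v i))).
  rewrite !mem_cat; apply/orP; left.
  by apply/allpairsP; exists (i, BMultinom mN); rewrite /= !mem_enum.
- move=> i b bM q qj; apply: (edge_moments_span v0 (bEP i b bM)) qj => g gE.
  apply: (u0 (fun u => edge_integral v i
     (fun x => peval (iter b (dirderiv (nu i)) u) x * g x))).
  rewrite !mem_cat; apply/orP; right; apply/orP; left.
  apply/flattenP; exists [seq (fun u : mpoly 2 R => edge_integral v i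
     (fun x => peval (iter b (dirderiv (nu i)) u) x * q x)) | q <- bE i b].
    by apply/allpairsP; exists (i, b); rewrite mem_enum mem_iota /= absM.
  exact: (map_f (fun q => fun u : mpoly 2 R => edge_integral v i
     (fun x => peval (iter b (dirderiv (nu i)) u) x * q x))).
- move=> q qB; apply: (triangle_moments_span v0 bTP) qB => g gT.
  apply: (u0 (fun u => triangle_integral v (fun x => peval u x * peval g x))).
  by rewrite !mem_cat; apply/orP; right; apply/orP; right; apply/map_f.
Qed.
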